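(* Let $(a_\ell,a_r)$ be a two-faced pair in a two-state non-commutative probability space $(\mathcal{A},\varphi,\psi)$. Then, as formal power series in the commuting variables $z,w$, $$C^{\mathrm{c}}_{(a_\ell,a_r)}\big(zM^\psi_{a_\ell}(z),wM^\psi_{a_r}(w)\big)+1=M^\psi_{a_\ell}(z)+M^\psi_{a_r}(w)+\left(1-\frac{M^\psi_{a_\ell}(z)}{M^\varphi_{a_\ell}(z)}\right)+\left(1-\frac{M^\psi_{a_r}(w)}{M^\varphi_{a_r}(w)}\right)-\frac{M^\psi_{a_\ell}(z)M^\psi_{a_r}(w)}{M^\psi_{(a_\ell,a_r)}(z,w)}\left(1-\frac{M^\varphi_{(a_\ell,a_r)}(z,w)}{M^\varphi_{a_\ell}(z)M^\varphi_{a_r}(w)}\right).$$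
   Context: A two-state non-commutative probability space is a triple $(\mathcal{A},\varphi,\psi)$ with $\mathcal{A}$ a complex unital algebra and $\varphi,\psi$ unital linear functionals on $\mathcal{A}$. A two-faced pair $(a_\ell,a_r)$ is an ordered pair of elements of $\mathcal{A}$ (left variable, right variable). **Bi-non-crossing partitions.** For $\chi:[n]\to\{\ell,r\}$ with $\chi^{-1}(\ell)=\{i_1<\cdots<i_p\}$, $\chi^{-1}(r)=\{i_{p+1}>\cdots>i_n\}$, let $\prec_\chi$ be the total order $i_1\prec_\chi\cdots\prec_\chi i_n$. $\mathcal{BNC}(\chi)$ is the set of partitions of $[n]$ that are non-crossing with respect to $\prec_\chi$. A block $V$ of $\pi\in\mathcal{BNC}(\chi)$ is interior if there is another block $W$ of $\pi$ with $\min_{\prec_\chi}W\prec_\chi\min_{\prec_\chi}V$ and $\max_{\prec_\chi}V\prec_\chi\max_{\prec_\chi}W$; otherwise exterior. **Cumulants.** For $V=\{v_1<\dots<v_m\}$, $(a_1,\dots,a_n)|_V=(a_{v_1},\dots,a_{v_m})$ and $\chi|_V$ is regarded as a map on $[m]$. The $(\ell,r)$-cumulants $\kappa_\chi$ and c-$(\ell,r)$-cumulants $\mathcal{K}_\chi$ are the multilinear functionals on $\mathcal{A}^n$ uniquely determined by $$\psi(a_1\cdots a_n)=\sum_{\pi\in\mathcal{BNC}(\chi)}\prod_{V\in\pi}\kappa_{\chi|_V}((a_1,\dots,a_n)|_V),$$ $$\varphi(a_1\cdots a_n)=\sum_{\pi\in\mathcal{BNC}(\chi)}\prod_{V\text{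 interior}}\kappa_{\chi|_V}((a_1,\dots,a_n)|_V)\prod_{V\text{ exterior}}\mathcal{K}_{\chi|_V}((a_1,\dots,a_n)|_V)$$ for all $n\ge1$, $\chi:[n]\to\{\ell,r\}$, $a_i\in\mathcal{A}$. Let $\chi_{m,n}:[m+n]\to\{\ell,r\}$ with $\chi_{m,n}^{-1}(\ell)=[m]$, and $\mathcal{K}_{m,n}(a_\ell,a_r)=\mathcal{K}_{\chi_{m,n}}(a_\ell,\dots,a_\ell,a_r,\dots,a_r)$ ($m$ copies of $a_\ell$ then $n$ copies of $a_r$). **Series.** For $a\in\mathcal{A}$: $M^\psi_a(z)=1+\sum_{m\ge1}\psi(a^m)z^m$, $M^\varphi_a(z)=1+\sum_{m\ge1}\varphi(a^m)z^m$. For the pair: $$M^\psi_{(a_\ell,a_r)}(z,w)=1+\sum_{m,n\ge0,\,m+n\ge1}\psi(a_\ell^ma_r^n)z^mw^n,\quad M^\varphi_{(a_\ell,a_r)}(z,w)=1+\sum_{m,n\ge0,\,m+n\ge1}\varphi(a_\ell^ma_r^n)z^mw^n,$$ $$C^{\mathrm{c}}_{(a_\ell,a_r)}(z,w)=1+\sum_{m,n\ge0,\,m+n\ge1}\mathcal{K}_{m,n}(a_\ell,a_r)z^mw^n.$$ *)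

(* Defs.v *)
From HB Require Import structures.
From mathcomp Require Import all_boot all_order all_algebra.
From mathcomp Require Import boolp reals complex.

Set Implicit Arguments.
Unset Strict Implicit.
Unset Printing Implicit Defensive.

Import GRing.Theory.
Local Open Scope ring_scope.

(** * Formal power series in two commuting variables z, w *)

(* [coef2 f m n] is the coefficient of z^m w^n. *)
Record fps2 (K : Type) := Fps2 { coef2 : nat -> nat -> K }.

Lemma fps2P (K : Type) (f g : fps2 K) : (forall i j, coef2 f i j = coef2 g i j) -> f = g.
Proof.
case: f g => [f] [g] /= fg; congr Fps2.
by apply: functional_extensionality_dep => i; apply: functional_extensionality_dep.
Qed.

HB.instance Definition _ (K : Type) := gen_eqMixin (fps2 K).
HB.instance Definition _ (K : Type) := gen_choiceMixin (fps2 K).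

Section Fps2Ring.
Variable K : comUnitRingType.
Implicit Types f g h : fps2 K.

Definition fps2_zero : fps2 K := Fps2 (fun _ _ => 0).
Definition fps2_opp f : fps2 K := Fps2 (fun i j => - coef2 f i j).
Definition fps2_add f g : fps2 K := Fps2 (fun i j => coef2 f i j + coef2 g i j).

Fact fps2_addA : associative fps2_add.
Proof. by move=> f g h; apply: fps2P => i j /=; rewrite addrA. Qed.
Fact fps2_addC : commutative fps2_add.
Proof. by move=> f g; apply: fps2P => i j /=; rewrite addrC. Qed.
Fact fps2_add0 : left_id fps2_zero fps2_add.
Proof. by move=> f; apply: fps2P => i j /=; rewrite add0r. Qed.
Fact fps2_addN : left_inverse fps2_zero fps2_opp fps2_add.
Proof. by move=> f; apply: fps2P => i j /=; rewrite addNr. Qed.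

HB.instance Definition _ :=
  GRing.isZmodule.Build (fps2 K) fps2_addA fps2_addC fps2_add0 fps2_addN.

Definition fps2_one : fps2 K := Fps2 (fun i j => ((i == 0) && (j == 0))%N%:R).
Definition fps2_mul f g : fps2 K :=
  Fps2 (fun i j => \sum_(b < j.+1) \sum_(a < i.+1)
                     coef2 f a b * coef2 g (i - a)%N (j - b)%N).

(* The ring axioms are transferred from {poly {poly K}} by truncation. *)
Let trunc (N : nat) f : {poly {poly K}} := \poly_(j < N) \poly_(i < N) coef2 f i j.

Let coef_trunc N f i j : (i < N)%N -> (j < N)%N -> (trunc N f)`_j`_i = coef2 f i j.
Proof. by move=> iN jN; rewrite coef_poly jN coef_poly iN. Qed.

Let coef_polyM (p q : {poly {poly K}}) i j :
  (p * q)`_j`_i = \sum_(b < j.+1) \sum_(a < i.+1) p`_b`_a * q`_(j - b)`_(i - a).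
Proof. by rewrite coefM coef_sum; apply: eq_bigr => b _; rewrite coefM. Qed.

Let agree N f (p : {poly {poly K}}) :=
  forall i j, (i < N)%N -> (j < N)%N -> p`_j`_i = coef2 f i j.

Let agreeT N f : agree N f (trunc N f).
Proof. by move=> i j iN jN; rewrite coef_trunc. Qed.

Let agreeM N f g p q : agree N f p -> agree N g q -> agree N (fps2_mul f g) (p * q).
Proof.
move=> fp gq i j iN jN; rewrite coef_polyM /=.
apply: eq_bigr => b _; apply: eq_bigr => a _.
have ai := ltn_ord a; have bj := ltn_ord b.
by rewrite fp ?gq // ?(leq_ltn_trans (leq_subr _ _)) // (leq_trans ai, leq_trans bj).
Qed.

Let agree1 N : agree N fps2_one 1.
Proof.
by move=> i j _ _; rewrite coef1; case: j => [|j] /=; rewrite ?andbT ?andbF ?coef1 ?coef0.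
Qed.

Let agreeD N f g p q : agree N f p -> agree N g q -> agree N (f + g) (p + q).
Proof. by move=> fp gq i j iN jN; rewrite !coefD fp // gq. Qed.

Let agreeP f g (p : nat -> {poly {poly K}}) :
  (forall N, agree N f (p N)) -> (forall N, agree N g (p N)) -> f = g.
Proof.
move=> fp gp; apply: fps2P => i j.
by rewrite -(fp (i + j).+1) ?(gp (i + j).+1) // ltnS ?leq_addr ?leq_addl.
Qed.

Fact fps2_mulA : associative fps2_mul.
Proof.
move=> f g h; apply: (@agreeP _ _ (fun N => trunc N f * (trunc N g * trunc N h))) => N.
  by do 2 ?apply: agreeM; apply: agreeT.
by rewrite mulrA; do 2 ?apply: agreeM; apply: agreeT.
Qed.

Fact fps2_mulC : commutative fps2_mul.
Proof.
move=> f g; apply: (@agreeP _ _ (fun N => trunc N f * trunc N g)) => N.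
  by apply: agreeM; apply: agreeT.
by rewrite mulrC; apply: agreeM; apply: agreeT.
Qed.

Fact fps2_mul1 : left_id fps2_one fps2_mul.
Proof.
move=> f; apply: (@agreeP _ _ (fun N => 1 * trunc N f)) => N.
  by apply: agreeM; [apply: agree1 | apply: agreeT].
by rewrite mul1r; apply: agreeT.
Qed.

Fact fps2_mulDl : left_distributive fps2_mul +%R.
Proof.
move=> f g h; apply: (@agreeP _ _ (fun N => (trunc N f + trunc N g) * trunc N h)) => N.
  by apply: agreeM; [apply: agreeD |]; apply: agreeT.
by rewrite mulrDl; apply: agreeD; apply: agreeM; apply: agreeT.
Qed.

Fact fps2_one_neq0 : fps2_one != 0.
Proof.
by apply/eqP => /(congr1 (fun f => coef2 f 0%N 0%N)) /eqP; rewrite oner_eq0.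
Qed.

HB.instance Definition _ := GRing.Zmodule_isComNzRing.Build (fps2 K)
  fps2_mulA fps2_mulC fps2_mul1 fps2_mulDl fps2_one_neq0.

Lemma coef2_0 i j : coef2 (0 : fps2 K) i j = 0. Proof. by []. Qed.
Lemma coef2_1 i j : coef2 (1 : fps2 K) i j = ((i == 0) && (j == 0))%N%:R.
Proof. by []. Qed.
Lemma coef2D f g i j : coef2 (f + g) i j = coef2 f i j + coef2 g i j.
Proof. by []. Qed.
Lemma coef2N f i j : coef2 (- f) i j = - coef2 f i j.
Proof. by []. Qed.
Lemma coef2M f g i j : coef2 (f * g) i j =
  \sum_(b < j.+1) \sum_(a < i.+1) coef2 f a b * coef2 g (i - a)%N (j - b)%N.
Proof. by []. Qed.
Lemma coef2_sum (I : Type) (r : seq I) (P : pred I) (F : I -> fps2 K) i j :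
  coef2 (\sum_(k <- r | P k) F k) i j = \sum_(k <- r | P k) coef2 (F k) i j.
Proof.
by elim/big_rec2: _ => [|k x y _ <-]; rewrite ?coef2_0 // coef2D.
Qed.

Definition fps2C (c : K) : fps2 K := Fps2 (fun i j => if (i == 0)%N && (j == 0)%N then c else 0).

Lemma coef2_Cmul c f i j : coef2 (fps2C c * f) i j = c * coef2 f i j.
Proof.
rewrite coef2M big_ord_recl /= big_ord_recl /= !subn0.
rewrite !big1 ?addr0 // => [b _|a _]; last by rewrite mul0r.
by rewrite big1 // => a _; rewrite andbF mul0r.
Qed.

Lemma coef2_exp_small f k i j :
  coef2 f 0 0 = 0 -> (i + j < k)%N -> coef2 (f ^+ k) i j = 0.
Proof.
move=> f0; elim: k i j => [|k IHk] i j // ijk.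
rewrite exprS coef2M big1 // => b _; rewrite big1 // => a _.
have [ab0|ab0] := posnP (a + b)%N.
  by move/eqP: ab0; rewrite addn_eq0 => /andP[/eqP-> /eqP->]; rewrite f0 mul0r.
rewrite IHk ?mulr0 //.
have ai := ltn_ord a; have bj := ltn_ord b.
rewrite !ltnS in ai bj.
rewrite -(ltn_add2l (a + b)) addnACA !subnKC //.
by rewrite (leq_trans ijk) // -add1n leq_add2r.
Qed.

(* The inverse of f = c (1 - x), with c a unit and x without constant term,
   is c^-1 (1 + x + x^2 + ...). *)
Definition fps2_unit : {pred fps2 K} := fun f => coef2 f 0 0 \is a GRing.unit.
Definition fps2_inv f : fps2 K :=
  if f \in fps2_unit then
    let c := (coef2 f 0 0)^-1 in
    let x := 1 - fps2C c * f in
    fps2C c * Fps2 (fun i j => \sum_(k < (i + j).+1) coef2 (x ^+ k) i j)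
  else f.

Fact fps2_mulVx : {in fps2_unit, left_inverse 1 fps2_inv *%R}.
Proof.
move=> f uf; rewrite /fps2_inv uf; set c := _^-1; set x := 1 - _; set g := Fps2 _.
have x0 : coef2 x 0 0 = 0 by rewrite coef2D coef2N coef2_Cmul mulVr // subrr.
rewrite mulrAC -[fps2C c * f](subKr 1) -/x.
apply: fps2P => i j; set N := (i + j).+1.
transitivity (coef2 ((1 - x) * \sum_(k < N) x ^+ k) i j).
  rewrite !coef2M; apply: eq_bigr => b _; apply: eq_bigr => a _; congr (_ * _).
  rewrite coef2_sum /=.
  have le_N : ((i - a + (j - b)).+1 <= N)%N by rewrite ltnS leq_add ?leq_subr.
  rewrite (big_ord_widen N (fun k => coef2 (x ^+ k) (i - a) (j - b))) //.
  rewrite big_mkcond; apply: eq_bigr => k _; case: ifPn => //.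
  by rewrite -leqNgt => Hk; rewrite coef2_exp_small.
have -> : (1 - x) * \sum_(k < N) x ^+ k = 1 - x ^+ N.
  by rewrite -opprB mulNr -subrX1 opprB.
by rewrite coef2D coef2N coef2_exp_small // subr0.
Qed.

Fact fps2_unitPl f g : g * f = 1 -> f \in fps2_unit.
Proof.
move/(congr1 (fun f => coef2 f 0%N 0%N)); rewrite coef2M !big_ord_recl !big_ord0 /= !addr0.
by move=> gf1; apply/unitrPr; exists (coef2 g 0 0); rewrite mulrC.
Qed.

Fact fps2_inv_out : {in [predC fps2_unit], fps2_inv =1 id}.
Proof. by move=> f /negbTE nuf; rewrite /fps2_inv nuf. Qed.

HB.instance Definition _ := GRing.ComNzRing_hasMulInverse.Build (fps2 K)
  fps2_mulVx fps2_unitPl fps2_inv_out.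

Definition fps2_z : fps2 K := Fps2 (fun i j => ((i == 1) && (j == 0))%N%:R).
Definition fps2_w : fps2 K := Fps2 (fun i j => ((i == 0) && (j == 1))%N%:R).

Lemma coef2_exp_exp_small g h m n i j : coef2 g 0 0 = 0 -> coef2 h 0 0 = 0 ->
  (i + j < m + n)%N -> coef2 (g ^+ m * h ^+ n) i j = 0.
Proof.
move=> g0 h0 ijmn; rewrite coef2M big1 // => b _; rewrite big1 // => a _.
have [abm|mab] := ltnP (a + b) m; first by rewrite coef2_exp_small ?mul0r.
rewrite [X in _ * X]coef2_exp_small ?mulr0 //.
have ai := ltn_ord a; have bj := ltn_ord b.
rewrite !ltnS in ai bj.
rewrite -(ltn_add2l (a + b)) addnACA !subnKC //.
by rewrite (leq_trans ijmn) // leq_add2r.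
Qed.

(* f(g(z,w), h(z,w)). Only meaningful when g and h have no constant term: then
   g^m h^n does not contribute to z^i w^j unless m + n <= i + j
   ([coef2_exp_exp_small]), so that the truncated sum is the full one. *)
Definition fps2_subst f g h : fps2 K :=
  Fps2 (fun i j => \sum_(m < (i + j).+1) \sum_(n < (i + j).+1)
                     coef2 f m n * coef2 (g ^+ m * h ^+ n) i j).

End Fps2Ring.

(** * Bi-non-crossing partitions *)

Inductive face := lft | rgt.

Section BiNonCrossing.
Variables (n : nat) (chi : {ffun 'I_n -> face}).
Implicit Types (V W : {set 'I_n}) (P : {set {set 'I_n}}).

(* Left indices in increasing order, then right indices in decreasing order. *)
Definition chi_lt (i j : 'I_n) : bool :=
  match chi i, chi j with
  | lft, lft => (i < j)%N
  | lft, rgt => true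
  | rgt, lft => false
  | rgt, rgt => (j < i)%N
  end.

Definition noncrossing P : bool :=
  [forall V in P, forall W in P, (V != W) ==>
    ~~ [exists i in V, exists j in W, exists k in V, exists l in W,
         [&& chi_lt i j, chi_lt j k & chi_lt k l]]].

Definition BNC P : bool := partition P [set: 'I_n] && noncrossing P.

Definition is_chi_min V i : bool :=
  (i \in V) && [forall j in V, (j != i) ==> chi_lt i j].
Definition is_chi_max V i : bool :=
  (i \in V) && [forall j in V, (j != i) ==> chi_lt j i].

Definition interior P V : bool :=
  [exists W in P, [&& W != V,
    [exists i, exists j, [&& is_chi_min W i, is_chi_min V j & chi_lt i j]] &
    [exists i, exists j, [&& is_chi_max V i, is_chi_max W j & chi_lt i j]]]].

End BiNonCrossing.

(** * Cumulants *)

(* [enum_val] lists the elements of V in increasing order. *)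
Definition restr (T : Type) (n : nat) (f : {ffun 'I_n -> T}) (V : {set 'I_n}) :
  {ffun 'I_#|V| -> T} := [ffun j => f (enum_val j)].

Definition set_arg (T : Type) (n : nat) (a : {ffun 'I_n -> T}) (i : 'I_n) (x : T) :
  {ffun 'I_n -> T} := [ffun j => if j == i then x else a j].

Definition cumulant_family (K : Type) (A : Type) :=
  forall n : nat, {ffun 'I_n -> face} -> {ffun 'I_n -> A} -> K.

Section Cumulants.
Variables (K : fieldType) (A : algType K).
Implicit Types (phi psi : A -> K) (kappa ckappa : cumulant_family K A).

Definition multilinear_family kappa : Prop :=
  forall n (chi : {ffun 'I_n -> face}) (a : {ffun 'I_n -> A}) (i : 'I_n),
    scalar (fun x : A => kappa n chi (set_arg a i x)).

Definition is_lr_cumulants psi kappa : Prop :=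
  multilinear_family kappa /\
  forall n (chi : {ffun 'I_n -> face}) (a : {ffun 'I_n -> A}), (0 < n)%N ->
    psi (\prod_(i < n) a i) =
      \sum_(P | BNC chi P) \prod_(V in P) kappa #|V| (restr chi V) (restr a V).

Definition is_c_lr_cumulants phi kappa ckappa : Prop :=
  multilinear_family ckappa /\
  forall n (chi : {ffun 'I_n -> face}) (a : {ffun 'I_n -> A}), (0 < n)%N ->
    phi (\prod_(i < n) a i) =
      \sum_(P | BNC chi P)
        ((\prod_(V in P | interior chi P V) kappa #|V| (restr chi V) (restr a V)) *
         (\prod_(V in P | ~~ interior chi P V) ckappa #|V| (restr chi V) (restr a V))).

(** * The series of a two-faced pair *)

(* 1 + \sum_(m + n >= 1) c m n z^m w^n *)
Definition series_of (c : nat -> nat -> K) : fps2 K :=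
  Fps2 (fun m n => if (m + n == 0)%N then 1 else c m n).

Definition moment_z phi (a : A) : fps2 K :=
  series_of (fun m n => if n == 0%N then phi (a ^+ m) else 0).
Definition moment_w phi (a : A) : fps2 K :=
  series_of (fun m n => if m == 0%N then phi (a ^+ n) else 0).
Definition moment_zw phi (al ar : A) : fps2 K :=
  series_of (fun m n => phi (al ^+ m * ar ^+ n)).

Definition chi_mn (m n : nat) : {ffun 'I_(m + n) -> face} :=
  [ffun i : 'I_(m + n) => if (i < m)%N then lft else rgt].
Definition pair_mn (al ar : A) (m n : nat) : {ffun 'I_(m + n) -> A} :=
  [ffun i : 'I_(m + n) => if (i < m)%N then al else ar].

Definition c_cumulant_series ckappa (al ar : A) : fps2 K :=
  series_of (fun m n => ckappa (m + n)%N (chi_mn m n) (pair_mn al ar m n)).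

End Cumulants.

(** * Existence and uniqueness of the cumulants *)

(* [itr] is [interior] for the c-cumulants and constantly false for the
   (l,r)-cumulants, so that one recursion covers both. *)

Section CumulantsExist.
Variables (K : fieldType) (A : algType K).
Implicit Types (kappa ckappa fam : cumulant_family K A).

Lemma restr_setT fam n (chi : {ffun 'I_n -> face}) (a : {ffun 'I_n -> A}) :
  fam _ (restr chi setT) (restr a setT) = fam n chi a.
Proof.
have E : n = #|[set: 'I_n]| by rewrite cardsT card_ord.
have ev (j : 'I_#|[set: 'I_n]|) : enum_val j = cast_ord (esym E) j.
  apply: val_inj; rewrite /= (enum_val_nth (cast_ord (esym E) j)).
  rewrite (_ : enum [set: 'I_n] = enum 'I_n); last by apply: eq_enum => i; rewrite !inE.
  by rewrite nth_enum_ord // -[X in (_ < X)%N](card_ord n) -cardsT.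
have: forall j, restr chi setT j = chi (cast_ord (esym E) j) by move=> j; rewrite ffunE ev.
have: forall j, restr a setT j = a (cast_ord (esym E) j) by move=> j; rewrite ffunE ev.
move: (restr chi setT) (restr a setT); move: E {ev}.
case: _ /; move=> f g fE gE.
by congr (fam _ _ _); apply/ffunP => j; rewrite ?fE ?gE cast_ord_id.
Qed.

Lemma BNC_setT n (chi : {ffun 'I_n -> face}) : (0 < n)%N -> BNC chi [set setT].
Proof.
move=> n0; apply/andP; split.
  rewrite /partition /cover /trivIset !big_set1 !eqxx /= inE [set0 == _]eq_sym.
  by rewrite /cover big_set1 eqxx -card_gt0 cardsT card_ord.
apply/forall_inP => V /set1P->; apply/forall_inP => W /set1P->.
by rewrite eqxx.
Qed.

Lemma BNC_block_lt n (chi : {ffun 'I_n -> face}) P V :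
  BNC chi P -> P != [set setT] -> V \in P -> (#|V| < n)%N.
Proof.
case/andP=> /and3P[covP trivP P0] _ neP VP.
rewrite -[n in (_ < n)%N]card_ord -cardsT proper_card // properEneq subsetT andbT.
apply: contraNneq neP => VT; rewrite eqEsubset sub1set -VT VP andbT.
apply/subsetP => W WP; rewrite inE; apply: contraNT P0 => WV.
have := trivIsetP trivP _ _ WP VP WV; rewrite VT -setI_eq0 setIT => /eqP <-.
by rewrite -?VT.
Qed.

Lemma restr_set_arg n (a : {ffun 'I_n -> A}) i x (V : {set 'I_n}) (iV : i \in V) :
  restr (set_arg a i x) V = set_arg (restr a V) (enum_rank_in iV i) x.
Proof.
apply/ffunP => j; rewrite !ffunE; congr (if _ then _ else _).
by rewrite -(inj_eq enum_val_inj) enum_rankK_in.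
Qed.

Lemma restr_set_arg_out n (a : {ffun 'I_n -> A}) i x (V : {set 'I_n}) :
  i \notin V -> restr (set_arg a i x) V = restr a V.
Proof.
move=> iV; apply/ffunP => j; rewrite !ffunE; case: eqP => // ji.
by case/negP: iV; rewrite -ji enum_valP.
Qed.

Variable itr : forall n, {ffun 'I_n -> face} -> {set {set 'I_n}} -> {set 'I_n} -> bool.
Hypothesis itr_setT : forall n (chi : {ffun 'I_n -> face}), itr chi [set setT] setT = false.

Let term kappa ckappa n (chi : {ffun 'I_n -> face}) (a : {ffun 'I_n -> A})
    (P : {set {set 'I_n}}) :=
  (\prod_(V in P | itr chi P V) kappa #|V| (restr chi V) (restr a V)) *
  (\prod_(V in P | ~~ itr chi P V) ckappa #|V| (restr chi V) (restr a V)).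

Let spec (phi : A -> K) kappa ckappa :=
  forall n (chi : {ffun 'I_n -> face}) (a : {ffun 'I_n -> A}), (0 < n)%N ->
  phi (\prod_(i < n) a i) = \sum_(P | BNC chi P) term kappa ckappa chi a P.

Let term_setT kappa ckappa n chi a : term kappa ckappa chi a [set setT] = ckappa n chi a.
Proof.
rewrite /term big_mkcondr big_set1 itr_setT mul1r big_mkcondr big_set1 itr_setT.
exact: restr_setT.
Qed.

Let eq_term kappa ck1 ck2 n (chi : {ffun 'I_n -> face}) a P :
  (forall m f (g : {ffun 'I_m -> A}), (0 < m < n)%N -> ck1 m f g = ck2 m f g) ->
  BNC chi P -> P != [set setT] -> term kappa ck1 chi a P = term kappa ck2 chi a P.
Proof.
move=> E ncP PT; congr (_ * _); apply: eq_bigr => V /andP[VP _]; apply: E.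
rewrite (BNC_block_lt ncP PT VP) andbT card_gt0.
by case/andP: ncP => /and3P[_ _ P0] _; apply: contraNneq P0 => <-.
Qed.

Let spec_unique phi kappa ck1 ck2 : spec phi kappa ck1 -> spec phi kappa ck2 ->
  forall n chi a, (0 < n)%N -> ck1 n chi a = ck2 n chi a.
Proof.
move=> s1 s2; elim/ltn_ind => n IHn chi a n0.
have := s1 n chi a n0; rewrite (s2 n chi a n0) (bigD1 _ (BNC_setT chi n0)).
rewrite [in RHS](bigD1 _ (BNC_setT chi n0)) /= !term_setT => /esym/eqP.
under eq_bigr => P /andP[ncP PT].
  rewrite (@eq_term kappa ck1 ck2) //; last by move=> m f g /andP[m0 mn]; apply: IHn.
  over.
by rewrite (can2_eq (addrK _) (subrK _)) addrK => /eqP.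
Qed.

Let term_linear kappa ckappa n (chi : {ffun 'I_n -> face}) a i P :
  multilinear_family kappa -> BNC chi P ->
  (forall V, V \in P -> forall f (b : {ffun 'I_#|V| -> A}) j,
     scalar (fun x => ckappa _ f (set_arg b j x))) ->
  scalar (fun x => term kappa ckappa chi (set_arg a i x) P).
Proof.
move=> linK ncP linC; have /andP[/and3P[/eqP covP trivP _] _] := ncP.
pose g V x := (if itr chi P V then kappa else ckappa) _ (restr chi V) (restr (set_arg a i x) V).
have termE x : term kappa ckappa chi (set_arg a i x) P = \prod_(V in P) g V x.
  rewrite (bigID (itr chi P)) /=; congr (_ * _); apply: eq_bigr => V /andP[_ intV].
    by rewrite /g intV.
  by rewrite /g (negbTE intV).
have iP : i \in cover P by rewrite covP inE.
have V0P : pblock P i \in P by rewrite pblock_mem.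
have iV0 : i \in pblock P i by rewrite mem_pblock.
have gE x V : (V \in P) && (V != pblock P i) -> g V x = g V 0.
  case/andP=> VP VV0; rewrite /g !restr_set_arg_out //.
    by apply: contraNN VV0 => iV; rewrite (def_pblock trivP VP iV).
  by apply: contraNN VV0 => iV; rewrite (def_pblock trivP VP iV).
pose p := \prod_(V in P | V != pblock P i) g V 0.
have gp z : \prod_(V in P) g V z = g (pblock P i) z * p.
  by rewrite (bigD1 _ V0P) /=; congr (_ * _); apply: eq_bigr (gE z).
move=> c x y; rewrite !termE !gp mulrA -mulrDl; congr (_ * _).
rewrite /g !(restr_set_arg _ _ iV0); case: ifP => _; first exact: linK.
exact: linC.
Qed.

Fixpoint cumulant_rec phi kappa (N n : nat) (chi : {ffun 'I_n -> face})
    (a : {ffun 'I_n -> A}) : K :=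
  if N is N'.+1 then
    phi (\prod_(i < n) a i) -
    \sum_(P | BNC chi P && (P != [set setT])) term kappa (cumulant_rec phi kappa N') chi a P
  else 0.

Let cumulant_rec_stable phi kappa N1 N2 n chi a : (n <= N1)%N -> (n <= N2)%N -> (0 < n)%N ->
  @cumulant_rec phi kappa N1 n chi a = @cumulant_rec phi kappa N2 n chi a.
Proof.
elim: N1 N2 n chi a => [|N1 IH] [|N2] n chi a; try by case: n chi a.
move=> nN1 nN2 n0 /=; congr (_ - _); apply: eq_bigr => P /andP[ncP PT].
apply: eq_term => // m f g /andP[m0 mn].
by apply: IH => //; rewrite -ltnS; apply: leq_trans mn _.
Qed.

Let prod_set_arg n (a : {ffun 'I_n -> A}) i :
  linear (fun x => \prod_(j < n) set_arg a i x j).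
Proof.
move=> c x y; have := index_enum_uniq 'I_n; have := mem_index_enum i.
elim: (index_enum _) => // j r IHr; rewrite inE /= => ir /andP[jr ur].
rewrite !big_cons; have [ij|ji] := eqVneq i j; last first.
  rewrite (negbTE ji) /= in ir; rewrite IHr //.
  by rewrite !ffunE eq_sym (negbTE ji) mulrDr scalerAr.
have rE z : \prod_(k <- r) set_arg a i z k = \prod_(k <- r) a k.
  rewrite !big_seq; apply: eq_bigr => k kr; rewrite ffunE; case: eqP => // ki.
  by rewrite -ij -ki kr in jr.
by rewrite !rE !ffunE -ij eqxx mulrDl scalerAl.
Qed.

Let cumulant_rec_linear (phi : {scalar A}) kappa N n chi (a : {ffun 'I_n -> A}) i :
  multilinear_family kappa ->
  scalar (fun x => cumulant_rec phi kappa N chi (set_arg a i x)).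
Proof.
move=> linK; elim: N n chi a i => [|N IH] n chi a i c x y /=.
  by rewrite mulr0 addr0.
rewrite prod_set_arg linearP /=.
rewrite (eq_bigr _ (fun P HP => term_linear a i linK (andP HP).1
  (fun V _ f b j => @IH _ f b j) c x y)).
by rewrite big_split /= -mulr_sumr mulrBr opprD addrACA.
Qed.

Let spec_exists (phi : {scalar A}) kappa : multilinear_family kappa ->
  exists2 ckappa, multilinear_family ckappa & spec phi kappa ckappa.
Proof.
move=> linK; exists (fun n => @cumulant_rec phi kappa n n).
  by move=> n chi a i; apply: cumulant_rec_linear.
move=> n chi a n0; rewrite (bigD1 _ (BNC_setT chi n0)) /= term_setT.
case: n chi a n0 => // n chi a _.
rewrite [cumulant_rec _ _ _ _ _]/=; apply/eqP; rewrite -subr_eq; apply/eqP.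
congr (_ - _); apply: eq_bigr => P /andP[ncP PT].
apply: eq_term => // m f g /andP[m0 mn].
by apply: cumulant_rec_stable => //; rewrite -ltnS.
Qed.

Lemma cumulants_exist_unique :
  (forall (phi : {scalar A}) kappa, multilinear_family kappa ->
    exists2 ckappa, multilinear_family ckappa & spec phi kappa ckappa) /\
  (forall phi kappa ck1 ck2, spec phi kappa ck1 -> spec phi kappa ck2 ->
    forall n (chi : {ffun 'I_n -> face}) (a : {ffun 'I_n -> A}), (0 < n)%N ->
    ck1 n chi a = ck2 n chi a).
Proof. by split; [apply: spec_exists | apply: spec_unique]. Qed.

End CumulantsExist.

Section CumulantsWellDefined.
Variables (K : fieldType) (A : algType K).
Implicit Types (kappa ckappa : cumulant_family K A).

Lemma interior_setT n (chi : {ffun 'I_n -> face}) : interior chi [set setT] setT = false.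
Proof. by apply/exists_inP => -[W /set1P->]; rewrite eqxx. Qed.

Lemma lr_cumulantsE kappa n (chi : {ffun 'I_n -> face}) (a : {ffun 'I_n -> A}) :
  \sum_(P | BNC chi P) \prod_(V in P) kappa #|V| (restr chi V) (restr a V) =
  \sum_(P : {set {set 'I_n}} | BNC chi P)
    ((\prod_(V in P | false) 0) *
     (\prod_(V in P | ~~ false) kappa #|V| (restr chi V) (restr a V))).
Proof.
apply: eq_bigr => P _; rewrite [X in _ = X * _]big_pred0 => [|V]; last by rewrite andbF.
by rewrite mul1r; apply: eq_bigl => V; rewrite andbT.
Qed.

Lemma lr_cumulants_exist (psi : {scalar A}) : exists kappa, is_lr_cumulants psi kappa.
Proof.
have [ex _] := @cumulants_exist_unique K A (fun _ _ _ _ => false) (fun _ _ => erefl).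
have [|kappa linK specK] := ex psi (fun _ _ _ => 0).
  by move=> n chi a i c x y; rewrite mulr0 addr0.
exists kappa; split; first exact: linK.
by move=> n chi a n0; rewrite lr_cumulantsE; exact: (specK n chi a n0).
Qed.

Lemma lr_cumulants_unique psi kappa1 kappa2 :
  is_lr_cumulants psi kappa1 -> is_lr_cumulants psi kappa2 ->
  forall n (chi : {ffun 'I_n -> face}) (a : {ffun 'I_n -> A}), (0 < n)%N ->
  kappa1 n chi a = kappa2 n chi a.
Proof.
have [_ uniq] := @cumulants_exist_unique K A (fun _ _ _ _ => false) (fun _ _ => erefl).
move=> [_ s1] [_ s2]; apply: (uniq psi (fun _ _ _ => 0)) => n chi a n0.
  by rewrite (s1 n chi) // lr_cumulantsE.
by rewrite (s2 n chi) // lr_cumulantsE.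
Qed.

Lemma c_lr_cumulants_exist (phi psi : {scalar A}) kappa : is_lr_cumulants psi kappa ->
  exists ckappa, is_c_lr_cumulants phi kappa ckappa.
Proof.
have [ex _] := @cumulants_exist_unique K A interior interior_setT.
by case=> linK _; have [ckappa] := ex phi kappa linK; exists ckappa.
Qed.

Lemma c_lr_cumulants_unique phi kappa ckappa1 ckappa2 :
  is_c_lr_cumulants phi kappa ckappa1 -> is_c_lr_cumulants phi kappa ckappa2 ->
  forall n (chi : {ffun 'I_n -> face}) (a : {ffun 'I_n -> A}), (0 < n)%N ->
  ckappa1 n chi a = ckappa2 n chi a.
Proof.
have [_ uniq] := @cumulants_exist_unique K A interior interior_setT.
by move=> [_ s1] [_ s2]; apply: uniq s1 s2.
Qed.

End CumulantsWellDefined.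

(* Main.v *)
(** Listing the letters of al^m ar^n in the order prec_chi, the block of the first
    letter is exterior; the blocks between two of its consecutive letters are interior
    and contribute psi-moments, and those after its last letter contribute a phi-moment.
    A first block without right letters leads to the equation
    Fl = 1 + z A Fl with A = sum_i K_{i,0} z^(i-1) Ml^(i-1), hence Ml - Ml / Fl = z Ml A,
    and similarly for the right face with B.  A first block with both kinds of letters
    has exactly one gap with letters of both kinds, whence
    F = Fr + z A F + z w M Y Fr with Y = sum_{i,j >= 1} K_{i,j} (z Ml)^(i-1) (w Mr)^(j-1).
    So F / (Fl Fr) = 1 + z w M Y, and it remains to add up
    C^c = 1 + z Ml A + w Mr B + z w Ml Mr Y.
    Here F = M^phi, M = M^psi, and l, r mark the one-variable series. *)

Require Import Defs.
From mathcomp Require Import all_boot all_order all_algebra.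
From mathcomp Require Import reals complex.
From mathcomp Require Import zify ring.

Import GRing.Theory.
Local Open Scope ring_scope.

(** * Weighted sums over noncrossing partitions *)

Section NoncrossingSums.
Context {K : comNzRingType}.

(** The body of [noncrossing] for an arbitrary relation. For [chi_lt chi] the two are convertible;
    [ord_lt] gives noncrossing partitions for the natural order. *)
Definition crossless {T : finType} (lt : rel T) (P : {set {set T}}) : bool :=
  [forall V in P, forall W in P, (V != W) ==>
    ~~ [exists i in V, exists j in W, exists k in V, exists l in W,
         [&& lt i j, lt j k & lt k l]]].

(** A pointwise form of [interior] that avoids minima and maxima; see [interiorE]. *)
Definition nested {T : finType} (lt : rel T) (P : {set {set T}}) (V : {set T}) : bool :=
  [exists W in P, [exists a in W, [forall v in V, lt a v]] &&
                  [exists b in W, [forall v in V, lt v b]]].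

Definition nc_weight {T : finType} (lt : rel T) (k c : {set T} -> K)
    (P : {set {set T}}) : K :=
  \prod_(V in P) (if nested lt P V then k V else c V).

(** The common shape of both moment-cumulant formulas: [k] weighs interior blocks and [c] exterior
    ones, and [c := k] gives the formula for psi. *)
Definition nc_sum {T : finType} (lt : rel T) (k c : {set T} -> K) (S : {set T}) : K :=
  \sum_(P | partition P S && crossless lt P) nc_weight lt k c P.

Lemma partition_elemP {T : finType} (P : {set {set T}}) (S : {set T}) :
  reflect [/\ forall B, B \in P -> exists x, x \in B,
              forall B x, B \in P -> x \in B -> x \in S,
              forall x, x \in S -> exists2 B, B \in P & x \in B &
              forall B C x, B \in P -> C \in P -> x \in B -> x \in C -> B = C]
          (partition P S).
Proof.
apply: (iffP idP) => [partP | [ne sub cov disj]].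
  have triv := partition_trivIset partP.
  split.
  - by move=> B BP; apply/set0Pn; apply: partition_neq0 partP BP.
  - by move=> B x BP xB; apply: (subsetP (partitionS partP BP)).
  - by move=> x; rewrite -(cover_partition partP) => /bigcupP[B BP xB]; exists B.
  - by move=> B C x BP CP xB xC; rewrite -(def_pblock triv BP xB) (def_pblock triv CP xC).
apply/and3P; split.
- apply/eqP/setP => x; apply/bigcupP/idP => [[B BP xB]|/cov[B BP xB]]; last by exists B.
  exact: sub BP xB.
- apply/trivIsetP => B C BP CP; apply: contraNT => /pred0Pn[x /andP[xB xC]].
  by apply/eqP; apply: disj BP CP xB xC.
- by apply/negP => /ne[x]; rewrite inE.
Qed.

Lemma crosslessP {T : finType} (lt : rel T) (P : {set {set T}}) :
  reflect (forall B C i j k l, B \in P -> C \in P -> i \in B -> j \in C -> k \in B ->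
             l \in C -> lt i j -> lt j k -> lt k l -> B = C)
          (crossless lt P).
Proof.
apply: (iffP forall_inP) => [nc B C i j k l BP CP iB jC kB lC ij jk kl | nc V VP].
  apply/eqP/negPn; apply/negP => neq.
  have /forall_inP/(_ C CP)/implyP/(_ neq)/negP := nc B BP; apply.
  apply/exists_inP; exists i => //; apply/exists_inP; exists j => //.
  by apply/exists_inP; exists k => //; apply/exists_inP; exists l => //; rewrite ij jk.
apply/forall_inP => W WP; apply/implyP; apply: contraNN.
case/exists_inP => i iV /exists_inP[j jW] /exists_inP[k kV] /exists_inP[l lW].
by case/and3P => ij jk kl; apply/eqP; apply: (nc V W i j k l).
Qed.

Lemma nestedP {T : finType} (lt : rel T) (P : {set {set T}}) (V : {set T}) :
  reflect (exists W a b, [/\ W \in P, a \in W, b \in W,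
             forall v, v \in V -> lt a v & forall v, v \in V -> lt v b])
          (nested lt P V).
Proof.
apply: (iffP exists_inP).
  case=> W WP /andP[/exists_inP[a aW /forall_inP aV] /exists_inP[b bW /forall_inP bV]].
  by exists W, a, b.
case=> W [a] [b] [WP aW bW aV bV]; exists W => //.
by apply/andP; split; apply/exists_inP; [exists a | exists b] => //; apply/forall_inP.
Qed.

Lemma nc_sum0 {T : finType} (lt : rel T) (k c : {set T} -> K) : nc_sum lt k c set0 = 1.
Proof.
rewrite /nc_sum (big_pred1 set0) => [|P].
  by rewrite /nc_weight big_set0.
rewrite partition_set0 /=; case: eqP => //= ->.
by apply/crosslessP => B C ? ? ? ?; rewrite inE.
Qed.

Lemma eq_nc_sum {T : finType} (lt : rel T) (k c k' c' : {set T} -> K) (S : {set T}) :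
  (forall V : {set T}, V \subset S -> V != set0 -> k V = k' V) ->
  (forall V : {set T}, V \subset S -> V != set0 -> c V = c' V) ->
  nc_sum lt k c S = nc_sum lt k' c' S.
Proof.
move=> kE cE; apply: eq_bigr => P /andP[partP _]; apply: eq_bigr => V VP.
by rewrite kE ?cE ?(partitionS partP VP) ?(partition_neq0 partP VP).
Qed.

(** An order embedding carries blocks, crossings and nestings over to its image. This serves to pass
    from [chi_lt] to the natural order. *)
Lemma nc_sum_imset {T1 T2 : finType} (lt1 : rel T1) (lt2 : rel T2) (f : T1 -> T2)
    (k c : {set T2} -> K) :
  injective f -> (forall x y, lt2 (f x) (f y) = lt1 x y) ->
  nc_sum lt2 k c (f @: setT) = nc_sum lt1 (fun V => k (f @: V)) (fun V => c (f @: V)) setT.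
Proof.
move=> injf ltf; have injF : injective (fun V : {set T1} => f @: V) by apply: imset_inj.
rewrite /nc_sum (reindex_onto (fun P : {set {set T1}} => (fun V : {set T1} => f @: V) @: P)
  (fun P => (fun V : {set T2} => f @^-1: V) @: P)); last first.
  move=> P /andP[partP _]; rewrite -imset_comp -[RHS]imset_id.
  apply: eq_in_imset => V VP /=; apply/setP => y; apply/imsetP/idP => [[x]|yV].
    by rewrite inE => fxV ->.
  have /imsetP[x _ yE] := subsetP (partitionS partP VP) y yV.
  by exists x; rewrite ?inE -?yE.
apply: eq_big => P; last first.
  move=> _; rewrite /nc_weight big_imset /=; last by move=> ? ? _ _; apply: injF.
  apply: eq_bigr => V VP; congr (if _ then _ else _); apply/nestedP/nestedP.
    case=> _ [_] [_] [/imsetP[W WP ->] /imsetP[a aW ->] /imsetP[b bW ->] aV bV].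
    exists W, a, b; split=> // v vV.
      by rewrite -ltf; apply: aV; apply: imset_f.
    by rewrite -ltf; apply: bV; apply: imset_f.
  case=> W [a] [b] [WP aW bW aV bV]; exists (f @: W), (f a), (f b).
  by split; rewrite ?imset_f // => _ /imsetP[v vV ->]; rewrite ltf ?aV ?bV.
have -> : ((fun V : {set T2} => f @^-1: V) @: ((fun V : {set T1} => f @: V) @: P) == P) = true.
  apply/eqP; rewrite -imset_comp -[RHS]imset_id; apply: eq_imset => V /=.
  by apply/setP => x; rewrite inE mem_imset.
rewrite andbT; apply/andP/andP => -[/partition_elemP[ne sub cov disj] /crosslessP nc].
  split; first apply/partition_elemP; first split.
  - move=> B BP; have [_ /imsetP[x xB _]] := ne _ (imset_f _ BP); by exists x.
  - by move=> *; rewrite inE.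
  - move=> x _; have [|_ /imsetP[B BP ->]] := cov (f x); first by rewrite imset_f ?inE.
    by rewrite mem_imset // => xB; exists B.
  - move=> B C x BP CP xB xC; apply: injF.
    by apply: (disj _ _ (f x)); rewrite ?imset_f.
  - apply/crosslessP => B C i j u l BP CP iB jC uB lC ij ju ul; apply: injF.
    by apply: (nc _ _ (f i) (f j) (f u) (f l)); rewrite ?imset_f ?ltf.
split; first apply/partition_elemP; first split.
- by move=> _ /imsetP[B BP ->]; have [x xB] := ne _ BP; exists (f x); rewrite imset_f.
- by move=> _ x /imsetP[B BP ->] /imsetP[y _ ->]; rewrite imset_f ?inE.
- move=> _ /imsetP[x _ ->]; have [|B BP xB] := cov x; first by rewrite inE.
  by exists (f @: B); rewrite ?imset_f.
- move=> _ _ _ /imsetP[B BP ->] /imsetP[C CP ->] /imsetP[x xB ->].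
  by rewrite mem_imset // => xC; rewrite (disj B C x).
- apply/crosslessP => _ _ _ _ _ _ /imsetP[B BP ->] /imsetP[C CP ->] /imsetP[i iB ->]
    /imsetP[j jC ->] /imsetP[u uB ->] /imsetP[l lC ->]; rewrite !ltf => ij ju ul.
  by rewrite (nc B C i j u l).
Qed.

End NoncrossingSums.

(** * Peeling off the block of the first letter, gap by gap *)

Section FirstBlock.
Context {K : comNzRingType}.
Implicit Types (T : finType).

Definition ord_lt {N : nat} : rel 'I_N := fun i j => (i < j)%N.
Definition ord_itv {N : nat} (s e : nat) : {set 'I_N} := [set i : 'I_N | (s <= i < e)%N].

(* The sum over the partitions in which V lies in one block; since V will consist of the
   first letters of a block, this allows to peel off one gap of that block at a time. *)
Definition nc_sum_through {T} (lt : rel T) (k c : {set T} -> K) (V S : {set T}) : K :=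
  \sum_(P | [&& partition P (V :|: S), crossless lt P & [exists B in P, V \subset B]])
     nc_weight lt k c P.

Lemma crossless_sub {T} (lt : rel T) (P Q : {set {set T}}) :
  Q \subset P -> crossless lt P -> crossless lt Q.
Proof.
move=> /subsetP QP /crosslessP nc; apply/crosslessP => B C i j k l /QP BP /QP CP.
exact: nc.
Qed.

(** All of [V] precedes the interval, so no other block crosses or encloses it and it encloses none.
    It is exterior with weight [c V], and removing it leaves an arbitrary noncrossing partition of
    the interval. *)
Lemma nc_sum_through_block {N : nat} (k c : {set 'I_N} -> K) (V : {set 'I_N}) (s e : nat) :
  V != set0 -> (forall v, v \in V -> (v < s)%N) ->
  \sum_(P : {set {set 'I_N}} | [&& partition P (V :|: ord_itv s e), crossless ord_lt P
                                 & [exists B in P, V \subset B]] && (V \in P))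
     nc_weight ord_lt k c P = c V * nc_sum ord_lt k c (ord_itv s e).
Proof.
move=> V0 Vs; have [v0 v0V] := set0Pn _ V0.
have VS x : x \in V -> x \in ord_itv s e -> False by rewrite inE => /Vs; lia.
rewrite /nc_sum mulr_sumr (reindex_onto (fun Q => V |: Q) (fun P => P :\ V)); last first.
  by move=> P /andP[_ VP]; rewrite setD1K.
have VQ (Q : {set {set 'I_N}}) : partition Q (ord_itv s e) -> V \notin Q.
  move=> /partition_elemP[_ sub _ _]; apply/negP => VQ.
  exact: VS v0V (sub _ _ VQ v0V).
apply: eq_big => Q.
  apply/idP/idP.
    case/andP=> /andP[/and3P[partP nc _] VP] /eqP QE.
    rewrite -QE (crossless_sub _ _ _ (subD1set _ _) nc) andbT.
    have := partitionD1 partP VP; rewrite setDUl setDv set0U.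
    rewrite [ord_itv s e :\: V](_ : _ = ord_itv s e) //.
    by apply/setDidPl/pred0P => x; apply/negP => /andP[xS xV]; apply: VS xV xS.
  case/andP=> partQ ncQ; have VnQ := VQ _ partQ.
  rewrite setU1K // eqxx setU11 !andbT; apply/and3P; split.
  - apply: partitionU1 => //; apply/pred0P => x.
    by apply/negP => /andP[xV xS]; apply: VS xV xS.
  - have /partition_elemP[_ sub _ _] := partQ.
    have Qge B x : B \in Q -> x \in B -> (s <= x)%N.
      by move=> BQ xB; have := sub _ _ BQ xB; rewrite inE => /andP[].
    apply/crosslessP => B C i j p l; rewrite /ord_lt.
    case/setU1P=> [->|BQ] /setU1P[->|CQ] // iB jC pB lC ij jp pl.
    - by move: jp (Qge _ _ CQ jC) (Vs _ pB); clear; lia.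
    - by move: ij (Qge _ _ BQ iB) (Vs _ jC); clear; lia.
    - by move/crosslessP: ncQ => /(_ B C i j p l); apply.
  - by apply/exists_inP; exists V; rewrite ?setU11.
case/andP=> /andP[/and3P[partP nc _] VP] /eqP QE.
have partQ : partition Q (ord_itv s e).
  rewrite -QE; have := partitionD1 partP VP; rewrite setDUl setDv set0U.
  rewrite [ord_itv s e :\: V](_ : _ = ord_itv s e) //.
  by apply/setDidPl/pred0P => x; apply/negP => /andP[xS xV]; apply: VS xV xS.
have /partition_elemP[ne sub _ _] := partQ.
have Qge B x : B \in Q -> x \in B -> (s <= x)%N.
  by move=> BQ xB; have := sub _ _ BQ xB; rewrite inE => /andP[].
rewrite /nc_weight big_setU1 ?VQ //=; congr (_ * _).
  case: nestedP => // -[W [a [b [WP aW bW aV bV]]]].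
  case/setU1P: WP => [WV|WQ]; first by have := aV a; rewrite -WV /ord_lt ltnn => /(_ aW).
  by move: (aV _ v0V) (Qge _ _ WQ aW) (Vs _ v0V); rewrite /ord_lt; clear; lia.
apply: eq_bigr => B BQ; have [x xB] := ne _ BQ; congr (if _ then _ else _).
apply/nestedP/nestedP => -[W [a [b [WP aW bW aB bB]]]]; last first.
  by exists W, a, b; split=> //; rewrite inE WP orbT.
exists W, a, b; split=> //; case/setU1P: WP => // WV.
move: bW; rewrite WV => /Vs.
by move: (Qge _ _ BQ xB) (bB _ xB); rewrite /ord_lt; clear; lia.
Qed.

(** Disjointness from [ord_itv s u] makes [u] the letter after [V] in its block. Blocks meeting this
    gap stay in it and are interior, whence a sum with weight [k] only; the other blocks form a
    partition in which [u] has joined [V]. *)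
Lemma nc_sum_through_gap {N : nat} (k c : {set 'I_N} -> K) (V : {set 'I_N}) (s e : nat)
    (u : 'I_N) :
  V != set0 -> (forall v, v \in V -> (v < s)%N) -> (s <= u < e)%N ->
  \sum_(P : {set {set 'I_N}} | [&& partition P (V :|: ord_itv s e), crossless ord_lt P
     & [exists B in P, (u |: V \subset B) && [disjoint B & ord_itv s u]]])
     nc_weight ord_lt k c P
  = nc_sum ord_lt k k (ord_itv s u) * nc_sum_through ord_lt k c (u |: V) (ord_itv u.+1 e).
Proof.
move=> /set0Pn[v0 v0V] Vs sue.
rewrite /nc_sum /nc_sum_through big_distrlr pair_big /=.
rewrite (reindex_onto (fun P : {set {set 'I_N}} => ([set B in P | B \subset ord_itv s u],
   [set B in P | ~~ (B \subset ord_itv s u)])) (fun Q => Q.1 :|: Q.2)); last first.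
  case=> Q1 Q2 /= /andP[/andP[/partition_elemP[_ sub1 _ _] _]].
  case/and3P=> /partition_elemP[ne2 sub2 _ _] _ _.
  have in1 B : B \in Q1 -> B \subset ord_itv s u.
    by move=> BQ; apply/subsetP => x; apply: sub1.
  have in2 B : B \in Q2 -> ~~ (B \subset ord_itv s u).
    move=> BQ; have [x xB] := ne2 _ BQ; apply/negP => /subsetP/(_ _ xB).
    have := sub2 _ _ BQ xB; rewrite !inE => /orP[/orP[/eqP ->|/Vs]|]; lia.
  congr (_, _); apply/setP => B; rewrite !inE.
    case B1: (B \in Q1); first by rewrite in1.
    by case B2: (B \in Q2) => //=; rewrite (negbTE (in2 _ B2)).
  case B2: (B \in Q2); first by rewrite in2 ?orbT.
  by case B1: (B \in Q1) => //=; rewrite in1.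
have lo x : x \in ord_itv s u -> x \notin (u |: V) :|: ord_itv u.+1 e.
  rewrite !inE => xi; apply/negP => /orP[/orP[/eqP xu|/Vs]|]; last by lia.
    by move: xi; rewrite xu; lia.
  by lia.
have lohi x : (x \in V :|: ord_itv s e) =
    (x \in ord_itv s u) || (x \in (u |: V) :|: ord_itv u.+1 e).
  rewrite !inE; case: (x \in V) => //=; rewrite ?orbT //.
  by rewrite -val_eqE /=; lia.
have hi x : x \in (u |: V) :|: ord_itv u.+1 e -> (x < s)%N || (u <= x)%N.
  by rewrite !inE => /orP[/orP[/eqP ->|/Vs ->]|] //; lia.
have PE (P : {set {set 'I_N}}) :
    [set B in P | B \subset ord_itv s u] :|: [set B in P | ~~ (B \subset ord_itv s u)] = P.
  by apply/setP => B; rewrite !inE -andb_orr orbN andbT.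
(* If a block other than [B0] met the gap in [x] and had a letter [y] beyond [u], then [v0], [x],
   [u], [y] would form a crossing. *)
have blk (P : {set {set 'I_N}}) B B0 x : partition P (V :|: ord_itv s e) -> crossless ord_lt P ->
    B0 \in P -> u |: V \subset B0 -> [disjoint B0 & ord_itv s u] -> B \in P -> x \in B ->
    x \in ord_itv s u -> B \subset ord_itv s u.
  move=> /partition_elemP[_ sub _ disj] /crosslessP nc B0P /subsetP uV dj BP xB xi.
  have neB : B <> B0.
    by move=> BB; move/pred0P: dj => /(_ x); rewrite /= -BB xB xi.
  apply/subsetP => y yB; have := sub _ _ BP yB; rewrite !lohi => /orP[//|].
  rewrite -setUA !inE => /or3P[yu|yV|yi].
  - by case: neB; apply: (disj _ _ y) => //; apply: uV; rewrite !inE yu.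
  - by case: neB; apply: (disj _ _ y) => //; apply: uV; rewrite !inE yV orbT.
  - case: neB; apply/esym/(nc _ _ v0 x u y) => //; rewrite ?uV ?inE ?v0V ?eqxx ?orbT //.
    + by move: xi (Vs _ v0V); rewrite inE /ord_lt; clear; lia.
    + by move: xi; rewrite inE /ord_lt; clear; lia.
    + by case/andP: yi.
apply: eq_big => P.
  rewrite /= PE eqxx andbT; apply/idP/idP.
    case/and3P=> partP ncP /exists_inP[B0 B0P /andP[uV dj]].
    have blkP B x := blk P B B0 x partP ncP B0P uV dj.
    have /partition_elemP[ne sub cov disj] := partP.
    rewrite !(crossless_sub _ _ _ _ ncP) ?andbT /=;
      try by apply/subsetP => B; rewrite inE => /andP[].
    apply/and3P; split.
    - apply/partition_elemP; split.
      + by move=> B; rewrite inE => /andP[/ne].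
      + by move=> B x; rewrite inE => /andP[_ /subsetP]; apply.
      + move=> x xi; have [|B BP xB] := cov x; first by rewrite lohi xi.
        by exists B; rewrite // inE BP (blkP B x).
      + by move=> B C x; rewrite !inE => /andP[BP _] /andP[CP _]; apply: disj.
    - apply/partition_elemP; split.
      + by move=> B; rewrite inE => /andP[/ne].
      + move=> B x; rewrite inE => /andP[BP Bni] xB.
        have := sub _ _ BP xB; rewrite lohi => /orP[xi|//].
        by rewrite (blkP B x) in Bni.
      + move=> x xi; have [|B BP xB] := cov x; first by rewrite lohi xi orbT.
        exists B; rewrite // inE BP; apply/negP => /subsetP/(_ _ xB)/lo.
        by rewrite xi.
      + by move=> B C x; rewrite !inE => /andP[BP _] /andP[CP _]; apply: disj.
    - apply/exists_inP; exists B0; rewrite // inE B0P.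
      apply/negP => /subsetP/(_ u); rewrite (subsetP uV) ?setU11 // inE => /(_ isT).
      by lia.
  set P1 := [set B in P | B \subset _]; set P2 := [set B in P | ~~ _].
  case/andP=> /andP[part1 nc1] /and3P[part2 nc2 /exists_inP[B0 B02 uV]].
  have /partition_elemP[ne1 sub1 cov1 disj1] := part1.
  have /partition_elemP[ne2 sub2 cov2 disj2] := part2.
  have P12 B : B \in P -> (B \in P1) || (B \in P2).
    by rewrite -[in X in X -> _](PE P) inE.
  have P1P B : B \in P1 -> B \in P by rewrite inE => /andP[].
  have P2P B : B \in P2 -> B \in P by rewrite inE => /andP[].
  have clash B C x : B \in P1 -> C \in P2 -> x \in B -> x \in C -> False.
    by move=> BP CP xB xC; have /negP := lo _ (sub1 _ _ BP xB); apply; apply: sub2 xC.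
  apply/and3P; split.
  - apply/partition_elemP; split.
    + by move=> B /P12/orP[/ne1|/ne2].
    + by move=> B x /P12/orP[BP|BP] xB; rewrite lohi ?(sub1 _ _ BP xB) // (sub2 _ _ BP xB) orbT.
    + move=> x; rewrite lohi => /orP[/cov1[B BP xB]|/cov2[B BP xB]]; exists B => //.
        exact: P1P.
      exact: P2P.
    + move=> B C x /P12/orP[BP|BP] /P12/orP[CP|CP] xB xC.
      * exact: disj1 xB xC.
      * by case: (clash B C x).
      * by case: (clash C B x).
      * exact: disj2 xB xC.
  - apply/crosslessP => B C i j p l /P12/orP[BP|BP] /P12/orP[CP|CP] iB jC pB lC ij jp pl.
    + by move/crosslessP: nc1 => /(_ B C i j p l); apply.
    + move: ij jp (sub1 _ _ BP iB) (sub1 _ _ BP pB); rewrite !inE /ord_lt.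
      by case/orP: (hi _ (sub2 _ _ CP jC)); clear; lia.
    + move: jp pl (sub1 _ _ CP jC) (sub1 _ _ CP lC); rewrite !inE /ord_lt.
      by case/orP: (hi _ (sub2 _ _ BP pB)); clear; lia.
    + by move/crosslessP: nc2 => /(_ B C i j p l); apply.
  - apply/exists_inP; exists B0; first exact: P2P.
    rewrite uV; apply/pred0P => x; apply/negP => /andP[xB xi].
    by have /negP := lo _ xi; apply; apply: sub2 xB.
case/and3P=> partP ncP /exists_inP[B0 B0P /andP[uV dj]].
have blkP B x := blk P B B0 x partP ncP B0P uV dj.
have /partition_elemP[ne sub cov disj] := partP.
rewrite {1}/nc_weight (bigID (fun B : {set 'I_N} => B \subset ord_itv s u)) /=; congr (_ * _).
  rewrite /nc_weight; apply: eq_big => B; first by rewrite inE.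
  (* On the gap side both weights are [k], so nesting within the gap does not matter ([if_same]); in
     [P] the block is enclosed by [v0] and [u]. *)
  case/andP=> BP /subsetP Bi; rewrite if_same ifT //.
  apply/nestedP; exists B0, v0, u; split=> //; rewrite ?(subsetP uV) ?inE ?v0V ?eqxx ?orbT //.
    by move=> v /Bi; move: (Vs _ v0V); rewrite inE /ord_lt; clear; lia.
  by move=> v /Bi; rewrite inE => /andP[].
rewrite /nc_weight; apply: eq_big => B; first by rewrite inE.
case/andP=> BP nBi; have [x xB] := ne _ BP; congr (if _ then _ else _).
(* An enclosing block cannot lie in the gap: its ends would force the letter [x] of [B] into the
   gap, and then all of [B]. *)
apply/nestedP/nestedP => -[W [a [b [WP aW bW aB bB]]]]; exists W, a, b; split=> //.
  rewrite inE WP; apply: contraNN nBi => /subsetP Wi; apply: (blkP B x) => //.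
  move: (Wi _ aW) (Wi _ bW) (aB _ xB) (bB _ xB); rewrite !inE /ord_lt; clear; lia.
by move: WP; rewrite inE => /andP[].
Qed.

(* Here u is the element that follows V in its block, if there is one. *)
Lemma nc_sum_throughE {N : nat} (k c : {set 'I_N} -> K) (V : {set 'I_N}) (s e : nat) :
  V != set0 -> (forall v, v \in V -> (v < s)%N) ->
  nc_sum_through ord_lt k c V (ord_itv s e) =
    c V * nc_sum ord_lt k c (ord_itv s e) +
    \sum_(u : 'I_N | (s <= u < e)%N)
      nc_sum ord_lt k k (ord_itv s u) * nc_sum_through ord_lt k c (u |: V) (ord_itv u.+1 e).
Proof.
move=> V0 Vs; have [v0 v0V] := set0Pn _ V0.
rewrite /nc_sum_through (bigID (fun P : {set {set 'I_N}} => V \in P)) /= nc_sum_through_block //.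
congr (_ + _); symmetry.
under eq_bigr => u sue do rewrite -nc_sum_through_gap //.
(* After the exchange, each [P] in which [V] is not a block must occur for exactly one [u]: the
   least letter outside [V] of the block containing [V]. *)
rewrite (exchange_big_dep (fun P : {set {set 'I_N}} =>
   [&& partition P (V :|: ord_itv s e), crossless ord_lt P & [exists B in P, V \subset B]] &&
   (V \notin P))) /=; last first.
  move=> u P sue /and3P[partP ncP /exists_inP[B BP /andP[uV dj]]].
  have /partition_elemP[_ _ _ disj] := partP.
  rewrite partP ncP /=; apply/andP; split.
    by apply/exists_inP; exists B; rewrite // (subset_trans (subsetUr _ _) uV).
  apply/negP => VP; have VB : V = B.
    by apply: (disj _ _ v0) => //; rewrite (subsetP uV) // inE v0V orbT.
  have : u \in V by rewrite VB (subsetP uV) // setU11.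
  by move/Vs; case/andP: sue => su _; rewrite ltnNge su.
apply: eq_bigr => P /andP[/and3P[partP ncP /exists_inP[B BP VB]] VnP].
have /partition_elemP[ne sub cov disj] := partP.
have /set0Pn[y0] : B :\: V != set0.
  rewrite setD_eq0; apply: contraNN VnP => BV.
  by rewrite (_ : V = B) //; apply/eqP; rewrite eqEsubset VB.
rewrite inE andbC => y0B.
have [u /andP[uB unV] umin] :=
  @arg_minnP _ y0 (fun y => (y \in B) && (y \notin V)) val y0B.
have usE : (s <= u < e)%N by have := sub _ _ BP uB; rewrite !inE (negbTE unV).
rewrite (big_pred1 u) // => u'; apply/idP/eqP => [|->]; last first.
  rewrite usE partP ncP; apply/exists_inP; exists B => //.
  rewrite subUset sub1set uB VB; apply/pred0P => z; apply/negP => /andP[/= zB].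
  rewrite inE => /andP[sz zu]; have := umin z; rewrite zB /= leqNgt zu.
  have -> : z \notin V by apply/negP => /Vs; rewrite ltnNge sz.
  by move=> /(_ isT).
case/andP=> su'e /and3P[_ _ /exists_inP[B' BP' /andP[uV' dj]]]; have /andP[su' _] := su'e.
have BB : B' = B.
  by apply: (disj _ _ v0); rewrite ?(subsetP VB) // (subsetP uV') // inE v0V orbT.
have u'B : u' \in B by rewrite -BB (subsetP uV') // setU11.
have u'V : u' \notin V by apply/negP => /Vs; rewrite ltnNge su'.
have := umin u'; rewrite u'B u'V => /(_ isT) uu'.
apply/val_inj/eqP => /=; rewrite eqn_leq uu' andbT leqNgt; apply/negP => ltu.
have uB' : u \in B' by rewrite BB.
by have := disjointFr dj uB'; rewrite inE ltu andbT; case/andP: usE => ->.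
Qed.

(** The first letter always lies in some block, so the existence condition in [nc_sum_through] holds
    for every partition of the interval. *)
Lemma nc_sum_first {N : nat} (k c : {set 'I_N} -> K) (s e : nat) (u : 'I_N) :
  s = u -> (u < e)%N ->
  nc_sum ord_lt k c (ord_itv s e) = nc_sum_through ord_lt k c [set u] (ord_itv s.+1 e).
Proof.
move=> su ue; have E : ord_itv s e = [set u] :|: ord_itv s.+1 e.
  by apply/setP => x; rewrite !inE -val_eqE /=; lia.
rewrite /nc_sum /nc_sum_through E; apply: eq_bigl => P.
case: (boolP (partition P _)) => // /partition_elemP[_ _ cov _] /=.
rewrite -[LHS]andbT; congr (_ && _); symmetry; apply/exists_inP.
by have [|B BP uB] := cov u; [rewrite !inE eqxx | exists B; rewrite ?sub1set].
Qed.

End FirstBlock.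

(** * Moments as sums over noncrossing partitions *)

Section Interior.
Variables (n : nat) (chi : {ffun 'I_n -> face}).

(** Turns [chi_lt] into [<] on numbers: left positions keep their index below [n], right positions
    get [2n - x], which exceeds [n] and decreases in [x]. *)
Definition chi_rank (x : 'I_n) : nat := if chi x is lft then x else (n + n - x)%N.

Lemma chi_ltE (x y : 'I_n) : chi_lt chi x y = (chi_rank x < chi_rank y)%N.
Proof.
rewrite /chi_lt /chi_rank; have := ltn_ord x; have := ltn_ord y.
by case: (chi x); case: (chi y); clear; lia.
Qed.

Lemma chi_rank_inj : injective chi_rank.
Proof.
move=> x y xy; apply/val_inj; move: xy; rewrite /= /chi_rank.
by move: (ltn_ord x) (ltn_ord y); case: (chi x); case: (chi y); clear; lia.
Qed.

Lemma chi_min_ex (V : {set 'I_n}) : V != set0 ->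
  exists2 i, is_chi_min chi V i & forall j, j \in V -> (chi_rank i <= chi_rank j)%N.
Proof.
case/set0Pn => x xV; have [i iV imin] := @arg_minnP _ x (mem V) chi_rank xV.
exists i => //; apply/andP; split=> //; apply/forall_inP => j jV; apply/implyP => ji.
by rewrite chi_ltE ltn_neqAle imin // andbT (inj_eq chi_rank_inj) eq_sym.
Qed.

Lemma chi_max_ex (V : {set 'I_n}) : V != set0 ->
  exists2 i, is_chi_max chi V i & forall j, j \in V -> (chi_rank j <= chi_rank i)%N.
Proof.
case/set0Pn => x xV; have [i iV imax] := @arg_maxnP _ x (mem V) chi_rank xV.
exists i => //; apply/andP; split=> //; apply/forall_inP => j jV; apply/implyP => ji.
by rewrite chi_ltE ltn_neqAle (inj_eq chi_rank_inj) ji; apply: imax.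
Qed.

(** Blocks of a partition are nonempty, so their extremes exist and comparing these amounts to the
    pointwise comparison. In [nested], [W != V] is automatic because the order is irreflexive. *)
Lemma interiorE (P : {set {set 'I_n}}) (V : {set 'I_n}) :
  partition P setT -> V \in P -> interior chi P V = nested (chi_lt chi) P V.
Proof.
move=> partP VP; have V0 := partition_neq0 partP VP.
apply/idP/nestedP => [/exists_inP[W WP]|[W [a [b [WP aW bW aV bV]]]]].
  case/and3P=> _ /existsP[a /existsP[a' /and3P[/andP[aW _] /andP[_ /forall_inP aV'] aa']]].
  case/existsP=> b' /existsP[b /and3P[/andP[_ /forall_inP bV'] /andP[bW _] bb']].
  exists W, a, b; split=> // v vV.
    have := aV' v vV; move: aa'; case: (eqVneq v a') => [-> //|_] /=.
    by rewrite !chi_ltE; apply: ltn_trans.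
  have := bV' v vV; move: bb'; case: (eqVneq v b') => [-> //|_] /=.
  by rewrite !chi_ltE => vb' b'b; apply: ltn_trans b'b vb'.
have W0 : W != set0 by apply/set0Pn; exists a.
apply/exists_inP; exists W => //; apply/and3P; split.
- by apply/eqP => WV; have := aV a; rewrite -WV chi_ltE ltnn => /(_ aW).
- have [i iW ilo] := chi_min_ex _ W0; have [j jV _] := chi_min_ex _ V0.
  apply/existsP; exists i; apply/existsP; exists j; rewrite iW jV chi_ltE /=.
  by apply: leq_ltn_trans (ilo _ aW) _; rewrite -chi_ltE aV //; case/andP: jV.
- have [i iV _] := chi_max_ex _ V0; have [j jW jhi] := chi_max_ex _ W0.
  apply/existsP; exists i; apply/existsP; exists j; rewrite iV jW chi_ltE /=.
  by apply: leq_trans (jhi _ bW); rewrite -chi_ltE bV //; case/andP: iV.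
Qed.

End Interior.

(** * Initial segments and increasing enumerations *)

Lemma card_ord_lt (n m : nat) : (m <= n)%N -> #|[set y : 'I_n | (y < m)%N]| = m.
Proof.
move=> mn; rewrite -sum1_card (eq_bigl (fun y : 'I_n => y < m)%N) => [|y].
  by rewrite (big_ord_narrow mn) sum1_card card_ord.
by rewrite inE.
Qed.

(** By counting: if [x] is in [D], then [D] contains the [x + 1] indices up to [x]; otherwise [D] is
    contained in the [x] indices below it. *)
Lemma down_closed_ord (n : nat) (D : {set 'I_n}) (x : 'I_n) :
  (forall x y : 'I_n, (x < y)%N -> y \in D -> x \in D) -> (x \in D) = (x < #|D|)%N.
Proof.
move=> down; apply/idP/idP => [xD | ].
  rewrite -[X in (X <= _)%N](@card_ord_lt n) //; apply/subset_leq_card/subsetP => y.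
  rewrite inE ltnS leq_eqVlt => /orP[/eqP/val_inj -> //|yx]; exact: down yx xD.
apply: contraLR => xD; rewrite -leqNgt -[X in (_ <= X)%N](@card_ord_lt n) ?(ltnW (ltn_ord x)) //.
apply/subset_leq_card/subsetP => y yD; rewrite inE ltnNge; apply: contraNN xD.
by rewrite leq_eqVlt => /orP[/eqP/val_inj -> //|/down]; apply.
Qed.

Lemma enum_val_ltn (n : nat) (V : {set 'I_n}) (x y : 'I_#|V|) :
  (x < y)%N -> (enum_val x < enum_val y)%N.
Proof.
move=> xy; pose d := enum_val x.
have srt : sorted ltn (map val (enum V)).
  have -> : enum V = [seq z <- enum 'I_n | z \in V] by rewrite enumT.
  rewrite sorted_map; apply: sorted_filter; first by move=> a b c; apply: ltn_trans.
  by rewrite -sorted_map val_enum_ord iota_ltn_sorted.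
have sz (z : 'I_#|V|) : (z < size (map val (enum V)))%N by rewrite size_map -cardE.
have := sorted_ltn_nth ltn_trans 0%N srt x y (sz x) (sz y) xy.
by rewrite !(nth_map d) -?cardE // -!enum_val_nth.
Qed.

(** * Cumulants and moments of words in one left and one right variable *)

Section PairCumulants.
Context {K : fieldType} {A : algType K}.
Variables (al ar : A).
Implicit Types (phi psi : {scalar A}) (kappa ckappa : cumulant_family K A).

Definition pair_cumulant kappa (i j : nat) : K :=
  kappa (i + j)%N (chi_mn i j) (pair_mn al ar i j).

(** The first [m] positions carry left letters, the others right letters. Only the number of each in
    the block matters, so positions may be permuted within a face. *)
Definition block_cumulant kappa (m : nat) {N : nat} (V : {set 'I_N}) : K :=
  pair_cumulant kappa #|[set x in V | (x < m)%N]| #|[set x in V | (m <= x)%N]|.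

Lemma pair_cumulantE kappa (n i j : nat) (chi : {ffun 'I_n -> face}) (a : {ffun 'I_n -> A}) :
  n = (i + j)%N -> (forall x, chi x = if (x < i)%N then lft else rgt) ->
  (forall x, a x = if (x < i)%N then al else ar) -> kappa n chi a = pair_cumulant kappa i j.
Proof.
move=> nE; subst n => chiE aE.
by congr (kappa _ _ _); apply/ffunP => x; rewrite ?chiE ?aE ffunE.
Qed.

(** The enumeration of [V] is increasing, so its left letters form an initial segment of the new
    indices, and the restricted word again consists of left letters followed by right ones. *)
Lemma restr_pair_cumulant kappa (p q : nat) (V : {set 'I_(p + q)}) :
  kappa #|V| (restr (chi_mn p q) V) (restr (pair_mn al ar p q) V) = block_cumulant kappa p V.
Proof.
set i := #|[set x in V | (x < p)%N]|.
have lftE (x : 'I_#|V|) : (enum_val x < p)%N = (x < i)%N.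
  pose D := [set x : 'I_#|V| | (enum_val x < p)%N].
  have -> : i = #|D|.
    rewrite -(card_imset _ (@enum_val_inj _ (mem V))); congr #|pred_of_set _|.
    apply/setP => y; rewrite inE; apply/andP/imsetP => [[yV yp]|[z]].
      by exists (enum_rank_in yV y); rewrite ?inE enum_rankK_in.
    by rewrite inE => zp ->; rewrite enum_valP.
  rewrite -(down_closed_ord _ D) ?inE // => y z yz; rewrite !inE.
  exact/ltn_trans/enum_val_ltn.
apply: pair_cumulantE => [|x|x]; rewrite ?ffunE ?lftE //.
rewrite -(cardsID [set x : 'I_(p + q) | (x < p)%N] V); congr (_ + _)%N; congr #|pred_of_set _|.
  by apply/setP => x; rewrite !inE.
by apply/setP => x; rewrite !inE -leqNgt andbC.
Qed.

Lemma prod_pair_mn (p q : nat) : \prod_(i < p + q) pair_mn al ar p q i = al ^+ p * ar ^+ q.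
Proof.
rewrite big_split_ord /=; congr (_ * _).
  by under eq_bigr do rewrite ffunE /= ltn_ord; rewrite prodr_const card_ord.
under eq_bigr do rewrite ffunE /= ltnNge leq_addr /=.
by rewrite prodr_const card_ord.
Qed.

Lemma c_moment_nc_sum phi kappa ckappa (p q : nat) : phi 1 = 1 ->
  is_c_lr_cumulants phi kappa ckappa ->
  nc_sum (chi_lt (chi_mn p q)) (block_cumulant kappa p) (block_cumulant ckappa p) setT =
  phi (al ^+ p * ar ^+ q).
Proof.
(* The moment-cumulant formula starts at length 1. For the empty word both sides are 1, by
   [phi1]. *)
move=> phi1 [_ phiE]; have [pq0|pq] := posnP (p + q).
  have setT0 : [set: 'I_(p + q)] = set0.
    by apply/setP => x; exfalso; move: (ltn_ord x) pq0; clear; lia.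
  rewrite setT0 nc_sum0; move/eqP: pq0; rewrite addn_eq0 => /andP[/eqP -> /eqP ->].
  by rewrite mulr1.
rewrite -prod_pair_mn (phiE _ (chi_mn p q)) //; apply: eq_bigr => P /andP[partP _].
rewrite /nc_weight (bigID (interior (chi_mn p q) P)) /=.
congr (_ * _); apply: eq_bigr => V /andP[VP]; rewrite interiorE //.
  by move=> ->; rewrite restr_pair_cumulant.
by move=> /negbTE ->; rewrite restr_pair_cumulant.
Qed.

(** [kappa] satisfies the c-cumulant formula for psi itself, since interior and exterior blocks then
    have the same weight. *)
Lemma moment_nc_sum psi kappa (p q : nat) : psi 1 = 1 -> is_lr_cumulants psi kappa ->
  nc_sum (chi_lt (chi_mn p q)) (block_cumulant kappa p) (block_cumulant kappa p) setT =
  psi (al ^+ p * ar ^+ q).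
Proof.
move=> psi1 [linK psiE]; apply: c_moment_nc_sum => //; split=> // n chi a n0.
by rewrite (psiE n chi) //; apply: eq_bigr => P _; rewrite (bigID (interior chi P)).
Qed.

(* The bijection reverses the right indices, which [chi_lt] lists in decreasing order. *)
Lemma nc_sum_itv kappa ckappa (N m s p q : nat) : (s + p + q <= N)%N ->
  (p == 0) || (s + p <= m)%N -> (q == 0) || (m <= s + p)%N ->
  nc_sum ord_lt (block_cumulant kappa m) (block_cumulant ckappa m) (@ord_itv N s (s + p + q)) =
  nc_sum (chi_lt (chi_mn p q)) (block_cumulant kappa p) (block_cumulant ckappa p) setT.
Proof.
move=> leN pm qm.
pose g (x : nat) := (if x < p then s + x else s + p + (p + q - x.+1))%N.
have gN (x : 'I_(p + q)) : (g x < N)%N.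
  by move: leN (ltn_ord x); rewrite /g; case: (ltnP x p); clear; lia.
pose f (x : 'I_(p + q)) := Ordinal (gN x).
have injf : injective f.
  move=> x y /(congr1 val) /= xy; apply/val_inj; move: xy (ltn_ord x) (ltn_ord y) => /=.
  by rewrite /g; case: (ltnP x p); case: (ltnP y p); clear; lia.
have -> : ord_itv s (s + p + q) = f @: setT.
  apply/setP => y; rewrite inE; apply/idP/imsetP => [/andP[sy ye]|[x _ ->]]; last first.
    by rewrite /= /g; move: (ltn_ord x); case: (ltnP x p); clear; lia.
  have [yp|py] := ltnP y (s + p).
    have hx : (y - s < p + q)%N by move: sy yp; clear; lia.
    exists (Ordinal hx); rewrite ?inE //; apply/val_inj; rewrite /= /g.
    by case: ltnP; move: sy yp; clear; lia.
  have hx : (s + p + p + q - y.+1 < p + q)%N by move: py ye; clear; lia.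
  exists (Ordinal hx); rewrite ?inE //; apply/val_inj; rewrite /= /g.
  by case: ltnP; move: py ye; clear; lia.
rewrite (nc_sum_imset (chi_lt (chi_mn p q)) ord_lt f) // => [|x y]; last first.
  rewrite /ord_lt /= /g /chi_lt !ffunE; move: (ltn_ord x) (ltn_ord y).
  by case: (ltnP x p); case: (ltnP y p); clear; lia.
have blk k (V : {set 'I_(p + q)}) : block_cumulant k m (f @: V) = block_cumulant k p V.
  (* [pm] and [qm] say that the first [p] positions of the interval are left and the last [q] right
     in the ambient word, so [f] preserves faces. *)
  have fm (x : 'I_(p + q)) : (f x < m)%N = (x < p)%N.
    by rewrite /= /g; move: pm qm (ltn_ord x); case: (ltnP x p); clear; lia.
  have -> : block_cumulant k m (f @: V) = pair_cumulant k
      #|f @: [set x in V | (x < p)%N]| #|f @: [set x in V | (p <= x)%N]|.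
    congr (pair_cumulant k _ _); apply: eq_card => y; rewrite inE; apply/andP/imsetP.
    - by case=> /imsetP[x xV ->]; rewrite fm; exists x; rewrite ?inE ?xV.
    - by case=> x; rewrite inE -fm => /andP[xV ?] ->; rewrite imset_f.
    - by case=> /imsetP[x xV ->]; rewrite leqNgt fm -leqNgt; exists x; rewrite ?inE ?xV.
    - by case=> x; rewrite inE leqNgt -fm -leqNgt => /andP[xV ?] ->; rewrite imset_f.
  by rewrite !card_imset.
by apply: eq_nc_sum => V _ _; rewrite blk.
Qed.

End PairCumulants.

(** * Substitution into power series *)

Section PowerSeries.
Context {K : comUnitRingType}.
Implicit Types (f g h : fps2 K).

Lemma coef2_zM f i j : coef2 (fps2_z K * f) i j = if i is i'.+1 then coef2 f i' j else 0.
Proof.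
rewrite coef2M big_ord_recl [X in _ + X]big1 ?addr0 => [|b _]; last first.
  by rewrite big1 // => a _; rewrite /= andbF mul0r.
case: i => [|i]; first by rewrite big_ord1 /= mul0r.
rewrite 2!big_ord_recl big1 => [|a _]; last by rewrite /= mul0r.
by rewrite /= !subn0 subSS subn0 mul0r add0r addr0 mul1r.
Qed.

Lemma coef2_wM f i j : coef2 (fps2_w K * f) i j = if j is j'.+1 then coef2 f i j' else 0.
Proof.
have col0 b : (\sum_(a < i.+1) coef2 (fps2_w K) a b * coef2 f (i - a)%N (j - b)%N
               = (b == 1)%N%:R * coef2 f i (j - b)%N).
  by rewrite big_ord_recl big1 ?addr0 ?subn0 // => a _; rewrite /= mul0r.
rewrite coef2M; under eq_bigr do rewrite col0.
case: j {col0} => [|j]; first by rewrite big_ord1 /= mul0r.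
rewrite 2!big_ord_recl big1 => [|b _]; last by rewrite /= mul0r.
by rewrite /= mul0r add0r addr0 mul1r subSS subn0.
Qed.

(** * Series in a single variable *)

Definition only_z f := forall i j, coef2 f i j.+1 = 0.
Definition only_w f := forall i j, coef2 f i.+1 j = 0.

Lemma coef2_only_zM f g i j : only_z f ->
  coef2 (f * g) i j = \sum_(a < i.+1) coef2 f a 0 * coef2 g (i - a)%N j.
Proof.
move=> zf; rewrite coef2M big_ord_recl [X in _ + X]big1 ?addr0 => [|b _].
  by under eq_bigr do rewrite subn0.
by rewrite big1 // => a _; rewrite zf mul0r.
Qed.

Lemma coef2_only_wM f g i j : only_w f ->
  coef2 (f * g) i j = \sum_(b < j.+1) coef2 f 0 b * coef2 g i (j - b)%N.
Proof.
move=> wf; rewrite coef2M; apply: eq_bigr => b _.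
by rewrite big_ord_recl big1 ?addr0 ?subn0 // => a _; rewrite wf mul0r.
Qed.

Lemma coef2M_only_w f g i j : only_w g ->
  coef2 (f * g) i j = \sum_(b < j.+1) coef2 f i b * coef2 g 0 (j - b)%N.
Proof.
move=> wg; rewrite coef2M; apply: eq_bigr => b _.
rewrite big_ord_recr /= subnn big1 ?add0r // => a _.
by rewrite -(subnSK (ltn_ord a)) wg mulr0.
Qed.

Lemma only_zM f g : only_z f -> only_z g -> only_z (f * g).
Proof. by move=> zf zg i j; rewrite coef2_only_zM // big1 // => a _; rewrite zg mulr0. Qed.

Lemma only_wM f g : only_w f -> only_w g -> only_w (f * g).
Proof. by move=> wf wg i j; rewrite coef2_only_wM // big1 // => b _; rewrite wg mulr0. Qed.

Lemma only_zX f n : only_z f -> only_z (f ^+ n).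
Proof.
move=> zf; elim: n => [|n IHn] i j; first by rewrite expr0 coef2_1 andbF.
by rewrite exprS only_zM.
Qed.

Lemma only_wX f n : only_w f -> only_w (f ^+ n).
Proof.
move=> wf; elim: n => [|n IHn] i j; first by rewrite expr0 coef2_1.
by rewrite exprS only_wM.
Qed.

Section Substitution.
Context {g h : fps2 K}.
Hypotheses (g0 : coef2 g 0 0 = 0) (h0 : coef2 h 0 0 = 0).

(** The bounds do not depend on the coefficient, so this is a finite sum in the ring of series and
    can be computed with there. *)
Definition subst_trunc (M N : nat) f : fps2 K :=
  \sum_(m < M) \sum_(n < N) fps2C (coef2 f m n) * (g ^+ m * h ^+ n).

(** As [g] and [h] have no constant term, indices beyond [i + j] contribute nothing. Having two
    separate bounds lets one of them grow when a variable is factored out. *)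
Lemma coef2_subst_trunc M N f i j : (i + j < M)%N -> (i + j < N)%N ->
  coef2 (fps2_subst f g h) i j = coef2 (subst_trunc M N f) i j.
Proof.
move=> ltM ltN; rewrite /subst_trunc coef2_sum /=.
rewrite (big_ord_widen M (fun m => \sum_(n < (i + j).+1)
  coef2 f m n * coef2 (g ^+ m * h ^+ n) i j)) // big_mkcond.
apply: eq_bigr => m _; rewrite coef2_sum; case: ifPn => [_|].
  rewrite (big_ord_widen N (fun n => coef2 f m n * coef2 (g ^+ m * h ^+ n) i j)) //.
  rewrite big_mkcond; apply: eq_bigr => n _; rewrite coef2_Cmul; case: ifPn => //.
  rewrite -leqNgt => lt_n; rewrite coef2_exp_exp_small ?mulr0 //.
  exact: leq_trans lt_n (leq_addl _ _).
rewrite -leqNgt => lt_m; rewrite big1 // => n _.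
by rewrite coef2_Cmul coef2_exp_exp_small ?mulr0 // (leq_trans lt_m) ?leq_addr.
Qed.

Lemma eq_coef2M f1 f2 f i j :
  (forall a b, (a + b <= i + j)%N -> coef2 f1 a b = coef2 f2 a b) ->
  coef2 (f * f1) i j = coef2 (f * f2) i j.
Proof.
move=> E; rewrite !coef2M; apply: eq_bigr => b _; apply: eq_bigr => a _.
by rewrite E // leq_add ?leq_subr.
Qed.

Lemma subst_zM f : fps2_subst (fps2_z K * f) g h = g * fps2_subst f g h.
Proof.
apply: fps2P => i j; pose N := (i + j).+1.
rewrite (eq_coef2M _ (subst_trunc N N f)) => [|a b ab]; last exact: coef2_subst_trunc.
rewrite (coef2_subst_trunc N.+1 N) ?ltnS ?leqnSn //; congr (coef2 _ _ _).
rewrite /subst_trunc big_ord_recl big1 ?add0r => [|n _]; last first.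
  rewrite coef2_zM; apply: fps2P => a b.
  by rewrite coef2_Cmul mul0r.
rewrite mulr_sumr; apply: eq_bigr => m _; rewrite mulr_sumr; apply: eq_bigr => n _.
by rewrite coef2_zM /= exprS; ring.
Qed.

Lemma subst_wM f : fps2_subst (fps2_w K * f) g h = h * fps2_subst f g h.
Proof.
apply: fps2P => i j; pose N := (i + j).+1.
rewrite (eq_coef2M _ (subst_trunc N N f)) => [|a b ab]; last exact: coef2_subst_trunc.
rewrite (coef2_subst_trunc N N.+1) ?ltnS ?leqnSn //; congr (coef2 _ _ _).
rewrite /subst_trunc mulr_sumr; apply: eq_bigr => m _.
rewrite big_ord_recl coef2_wM [X in X + _](_ : _ = 0) ?add0r; last first.
  by apply: fps2P => a b; rewrite coef2_Cmul mul0r.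
rewrite mulr_sumr; apply: eq_bigr => n _.
by rewrite coef2_wM /= exprS; ring.
Qed.

Lemma substD f1 f2 : fps2_subst (f1 + f2) g h = fps2_subst f1 g h + fps2_subst f2 g h.
Proof.
apply: fps2P => i j; rewrite coef2D /= -big_split; apply: eq_bigr => m _ /=.
by rewrite -big_split; apply: eq_bigr => n _; rewrite /= mulrDl.
Qed.

Lemma substC c : fps2_subst (fps2C c) g h = fps2C c.
Proof.
apply: fps2P => i j; transitivity (\sum_(m < (i + j).+1) \sum_(n < (i + j).+1)
  coef2 (fps2C c) m n * coef2 (g ^+ m * h ^+ n) i j); first by [].
rewrite big_ord_recl [X in _ + X]big1 ?addr0 => [|m _]; last first.
  by rewrite big1 // => n _; rewrite mul0r.
rewrite big_ord_recl [X in _ + X]big1 ?addr0 => [|n _]; last by rewrite mul0r.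
by rewrite !expr0 mulr1 coef2_1 /=; case: ifP; rewrite ?mulr1 ?mulr0.
Qed.

Lemma only_z_subst f : only_z g -> only_z f -> only_z (fps2_subst f g h).
Proof.
move=> zg zf i j; apply: big1 => m _; apply: big1 => -[[|n] ltn] _.
  by rewrite expr0 mulr1 only_zX // mulr0.
by rewrite zf mul0r.
Qed.

Lemma only_w_subst f : only_w h -> only_w f -> only_w (fps2_subst f g h).
Proof.
move=> wh wf i j; apply: big1 => -[[|m] ltm] _; apply: big1 => n _.
  by rewrite expr0 mul1r only_wX // mulr0.
by rewrite wf mul0r.
Qed.

End Substitution.
End PowerSeries.

(** * The series of a two-faced pair *)

Lemma sum_ord_itv {V : nmodType} (N s d : nat) (F : nat -> V) : (s + d <= N)%N ->
  \sum_(u < N | (s <= u < s + d)%N) F u = \sum_(b < d) F (s + b)%N.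
Proof.
elim: d => [|d IHd] sdN.
  by rewrite big_ord0 big_pred0 // => u; rewrite addn0; apply/negP; clear; lia.
have ltN : (s + d < N)%N by move: sdN; clear; lia.
rewrite big_ord_recr /= -IHd ?(ltnW ltN) // (bigD1 (Ordinal ltN)) /=; last by clear; lia.
rewrite addrC; congr (_ + _); apply: eq_bigl => u.
by rewrite -val_eqE /=; clear; lia.
Qed.

(** Used with [x < m] and [m <= x] to update the numbers of left and right letters when a block
    gains a letter. *)
Lemma card_sep_setU1 {N : nat} (p : pred nat) (u : 'I_N) (V : {set 'I_N}) : u \notin V ->
  #|[set x in u |: V | p (val x)]| = (p u + #|[set x in V | p (val x)]|)%N.
Proof.
move=> uV; case pu: (p u) => /=.
  rewrite (_ : [set x in u |: V | p (val x)] = u |: [set x in V | p (val x)]).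
    by rewrite cardsU1 inE (negbTE uV).
  by apply/setP => x; rewrite !inE; case: eqP => // ->; rewrite pu.
rewrite add0n; congr #|pred_of_set _|; apply/setP => x; rewrite !inE.
by case: eqP => // ->; rewrite /= pu andbF.
Qed.

Section PairSeries.
Context {K : fieldType} {A : algType K} (phi psi : {scalar A})
  (kappa ckappa : cumulant_family K A) (al ar : A).
Hypotheses (phi1 : phi 1 = 1) (psi1 : psi 1 = 1).
Hypotheses (kappaP : is_lr_cumulants psi kappa) (ckappaP : is_c_lr_cumulants phi kappa ckappa).

Let Kc := pair_cumulant al ar ckappa.
Let Ml := moment_z psi al.
Let Mr := moment_w psi ar.
Let Fl := moment_z phi al.
Let Fr := moment_w phi ar.
Let M := moment_zw psi al ar.
Let F := moment_zw phi al ar.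
Let z := fps2_z K.
Let w := fps2_w K.
Let g := z * Ml.
Let h := w * Mr.

Lemma coef2_moment_z (f : {scalar A}) a i j : f 1 = 1 ->
  coef2 (moment_z f a) i j = if j is 0 then f (a ^+ i) else 0.
Proof. by move=> f1; rewrite /=; case: i j => [|i] [|j]; rewrite ?expr0. Qed.

Lemma coef2_moment_w (f : {scalar A}) a i j : f 1 = 1 ->
  coef2 (moment_w f a) i j = if i is 0 then f (a ^+ j) else 0.
Proof. by move=> f1; rewrite /=; case: i j => [|i] [|j]; rewrite ?expr0. Qed.

Lemma coef2_moment_zw (f : {scalar A}) a b i j : f 1 = 1 ->
  coef2 (moment_zw f a b) i j = f (a ^+ i * b ^+ j).
Proof. by move=> f1; rewrite /=; case: i j => [|i] [|j]; rewrite ?expr0 ?mulr1. Qed.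

(** The block already has [i] left and [j] right letters, and the exponents count those still to
    come: both kinds here, one kind in the next two. After substitution, [z_cumulants 1],
    [w_cumulants 0 1] and [zw_cumulants 1 1] become A, B and Y. *)
Definition zw_cumulants i j : fps2 K := Fps2 (fun a b => Kc (i + a) (j + b)).
Definition z_cumulants i : fps2 K := Fps2 (fun a b => if b is 0 then Kc (i + a) 0 else 0).
Definition w_cumulants i j : fps2 K := Fps2 (fun a b => if a is 0 then Kc i (j + b) else 0).

Lemma zw_cumulantsE i j : zw_cumulants i j = w_cumulants i j + z * zw_cumulants i.+1 j.
Proof.
by apply: fps2P => -[|a] b; rewrite coef2D coef2_zM /= ?addr0 ?add0r ?addn0 // addSnnS.
Qed.

Lemma z_cumulantsE i : z_cumulants i = fps2C (Kc i 0) + z * z_cumulants i.+1.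
Proof.
apply: fps2P => -[|a] [|b]; rewrite coef2D coef2_zM /= ?addr0 ?add0r ?addn0 //.
by rewrite addSnnS.
Qed.

Lemma w_cumulantsE i j : w_cumulants i j = fps2C (Kc i j) + w * w_cumulants i j.+1.
Proof.
apply: fps2P => -[|a] [|b]; rewrite coef2D coef2_wM /= ?addr0 ?add0r ?addn0 //.
by rewrite addSnnS.
Qed.

Lemma c_cumulant_seriesE : c_cumulant_series ckappa al ar =
  fps2C 1 + z * z_cumulants 1 + w * w_cumulants 0 1 + z * (w * zw_cumulants 1 1).
Proof.
have zS (f : fps2 K) i j : coef2 (z * f) i.+1 j = coef2 f i j by rewrite coef2_zM.
have z0 (f : fps2 K) j : coef2 (z * f) 0 j = 0 by rewrite coef2_zM.
have wS (f : fps2 K) i j : coef2 (w * f) i j.+1 = coef2 f i j by rewrite coef2_wM.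
have w0 (f : fps2 K) i : coef2 (w * f) i 0 = 0 by rewrite coef2_wM.
by apply: fps2P => -[|i] [|j]; rewrite !coef2D !(zS, z0, wS, w0) /= ?addr0 ?add0r.
Qed.

Let S f := fps2_subst f g h.
(* The generating series, in the numbers of left and right letters that remain, of the
   sums over the partitions in which a block that already has i left and j right
   letters is to be completed; [right_open] is for the words without left letters. *)
Definition right_open i j : fps2 K := S (w_cumulants i j) * Fr.
Definition left_open i : fps2 K := S (z_cumulants i) * F + w * M * (S (zw_cumulants i 1) * Fr).

Let g0 : coef2 g 0 0 = 0. Proof. by rewrite coef2_zM. Qed.
Let h0 : coef2 h 0 0 = 0. Proof. by rewrite coef2_wM. Qed.

(** Series form of [nc_sum_throughE]: either the block ends and the remaining letters give a
    phi-moment, or a gap with a psi-moment and the next letter w follow. *)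
Lemma right_openE i j : right_open i j = fps2C (Kc i j) * Fr + w * (Mr * right_open i j.+1).
Proof. by rewrite /right_open w_cumulantsE /S substD substC subst_wM // /h; ring. Qed.

(** Now the next letter may be left or right. Before a right one, the gap contains all remaining
    left letters, hence the factor [M]. *)
Lemma left_openE i :
  left_open i = fps2C (Kc i 0) * F + z * (Ml * left_open i.+1) + w * (M * right_open i 1).
Proof.
rewrite /left_open /right_open z_cumulantsE zw_cumulantsE /S !substD substC !subst_zM // /g.
by ring.
Qed.

Let wMr : only_w Mr. Proof. by move=> i j; rewrite coef2_moment_w. Qed.
Let wFr : only_w Fr. Proof. by move=> i j; rewrite coef2_moment_w. Qed.
Let zMl : only_z Ml. Proof. by move=> i j; rewrite coef2_moment_z. Qed.
Let zFl : only_z Fl. Proof. by move=> i j; rewrite coef2_moment_z. Qed.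
Let wh : only_w h. Proof. by apply: only_wM => // i j; rewrite /=. Qed.
Let zg : only_z g. Proof. by apply: only_zM => // i j; rewrite /= andbF. Qed.

Lemma only_w_right_open i j : only_w (right_open i j).
Proof. by apply: only_wM => //; apply: only_w_subst. Qed.

(** * Open-block sums as coefficients of series *)

Lemma nc_sum_itv_phi (N m s p q : nat) : (s + p + q <= N)%N ->
  (p == 0) || (s + p <= m)%N -> (q == 0) || (m <= s + p)%N ->
  nc_sum ord_lt (block_cumulant al ar kappa m) (block_cumulant al ar ckappa m)
    (@ord_itv N s (s + p + q)) = phi (al ^+ p * ar ^+ q).
Proof. by move=> *; rewrite nc_sum_itv // (c_moment_nc_sum _ _ phi). Qed.

Lemma nc_sum_itv_psi (N m s p q : nat) : (s + p + q <= N)%N ->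
  (p == 0) || (s + p <= m)%N -> (q == 0) || (m <= s + p)%N ->
  nc_sum ord_lt (block_cumulant al ar kappa m) (block_cumulant al ar kappa m)
    (@ord_itv N s (s + p + q)) = psi (al ^+ p * ar ^+ q).
Proof. by move=> *; rewrite nc_sum_itv // (moment_nc_sum _ _ psi). Qed.

Let through m {N : nat} (V S : {set 'I_N}) :=
  nc_sum_through ord_lt (block_cumulant al ar kappa m) (block_cumulant al ar ckappa m) V S.

(** Induction on the number of letters after [u], all of them right: [nc_sum_throughE] and
    [right_openE] agree term by term. *)
Lemma through_right (N m : nat) (V : {set 'I_N}) (u : 'I_N) : (m <= u)%N -> u \in V ->
  (forall v, v \in V -> (v <= u)%N) ->
  through m V (ord_itv u.+1 N) =
  coef2 (right_open #|[set x in V | (x < m)%N]| #|[set x in V | (m <= x)%N]|) 0 (N - u.+1).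
Proof.
have [d] := ubnP (N - u.+1)%N; elim: d V u => // d IHd V u ltd mu uV Vu.
have V0 : V != set0 by apply/set0Pn; exists u.
have uN := ltn_ord u; have [q Nq] : exists q, N = (u.+1 + q)%N.
  by exists (N - u.+1)%N; rewrite subnKC.
have Nuq : (N - u.+1 = q)%N by move: Nq; clear; lia.
rewrite /through nc_sum_throughE // right_openE coef2D coef2_Cmul; congr (_ * _ + _).
  have -> : ord_itv u.+1 N = @ord_itv N u.+1 (u.+1 + 0 + q) by rewrite addn0 -Nq.
  rewrite nc_sum_itv_phi ?addn0 -?Nq // ?(leqW mu) ?orbT //.
  by rewrite expr0 mul1r coef2_moment_w // Nuq.
transitivity (\sum_(v < N | (u.+1 <= v < u.+1 + q)%N) psi (ar ^+ (v - u.+1)) *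
  coef2 (right_open #|[set x in V | (x < m)%N]| #|[set x in V | (m <= x)%N]|.+1) 0 (N - v.+1)).
  rewrite -Nq; apply: eq_bigr => v /andP[uv vN]; congr (_ * _).
    have -> : ord_itv u.+1 v = @ord_itv N u.+1 (u.+1 + 0 + (v - u.+1)).
      by rewrite addn0 subnKC.
    rewrite nc_sum_itv_psi ?addn0 ?subnKC ?(ltnW vN) // ?(leqW mu) ?orbT //.
    by rewrite expr0 mul1r.
  have vV : v \notin V by apply/negP => /Vu; rewrite leqNgt uv.
  rewrite -/(through _ _ _) IHd ?setU11 //.
  - rewrite (card_sep_setU1 (fun x => x < m)%N) // (card_sep_setU1 (leq m)) //.
    by rewrite (leq_trans mu (ltnW uv)) ltnNge (leq_trans mu (ltnW uv)).
  - by move: ltd uv vN; clear; lia.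
  - exact: leq_trans mu (ltnW uv).
  - by move=> x /setU1P[-> //|/Vu xu]; apply: leq_trans xu (ltnW uv).
(* Indexed by the length of the gap, the sum becomes a convolution with [Mr]; the factor w accounts
   for the letter [v] itself. *)
rewrite (sum_ord_itv N u.+1 q (fun v => psi (ar ^+ (v - u.+1)) * coef2 (right_open
  #|[set x in V | (x < m)%N]| #|[set x in V | (m <= x)%N]|.+1) 0 (N - v.+1))) -?Nq //.
rewrite Nuq.
rewrite coef2_wM; case: q Nq Nuq => [|q] Nq Nuq; first by rewrite big_ord0.
rewrite coef2_only_wM //; apply: eq_bigr => b _.
rewrite coef2_moment_w // addKn; congr (_ * coef2 _ _ _).
by move: Nq; clear; lia.
Qed.

(** The same induction over the remaining left letters; once the block takes a right letter,
    [through_right] applies. *)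
Lemma through_left (m n : nat) (V : {set 'I_(m + n)}) (u : 'I_(m + n)) : (u < m)%N -> u \in V ->
  (forall v, v \in V -> (v <= u)%N) ->
  through m V (ord_itv u.+1 (m + n)) = coef2 (left_open #|V|) (m - u.+1) n.
Proof.
have [d] := ubnP (m - u.+1)%N; elim: d V u => // d IHd V u ltd um uV Vu.
have V0 : V != set0 by apply/set0Pn; exists u.
have VL : [set x in V | (x < m)%N] = V.
  by apply/setP => x; rewrite inE andb_idr // => /Vu xu; apply: leq_ltn_trans xu um.
have VR : [set x in V | (m <= x)%N] = set0.
  apply/setP => x; rewrite !inE; apply/negP => /andP[/Vu xu].
  by rewrite leqNgt (leq_ltn_trans xu um).
have [p mp] : exists p, m = (u.+1 + p)%N by exists (m - u.+1)%N; rewrite subnKC.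
have mup : (m - u.+1 = p)%N by move: mp; clear; lia.
rewrite /through nc_sum_throughE // left_openE !coef2D coef2_Cmul -addrA mup.
congr (_ * _ + _).
- by rewrite /block_cumulant VL VR cards0.
- have -> : ord_itv u.+1 (m + n) = @ord_itv (m + n) u.+1 (u.+1 + p + n) by rewrite -mp.
  by rewrite nc_sum_itv_phi -?mp ?leqnn ?orbT // coef2_moment_zw.
rewrite (bigID (fun v : 'I_(m + n) => (v < m)%N)); congr (_ + _).
  transitivity (\sum_(v < m + n | (u.+1 <= v < u.+1 + p)%N) psi (al ^+ (v - u.+1)) *
    coef2 (left_open #|V|.+1) (m - v.+1) n).
    rewrite -mp; apply: eq_big => v /=; first by move: um (ltn_ord v); clear; lia.
    case/andP=> /andP[uv vN] vm; congr (_ * _).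
      have -> : ord_itv u.+1 v = @ord_itv (m + n) u.+1 (u.+1 + (v - u.+1) + 0).
        by rewrite addn0 subnKC.
      rewrite nc_sum_itv_psi ?addn0 ?subnKC ?(ltnW vN) // ?(ltnW vm) ?orbT //.
      by rewrite expr0 mulr1.
    have vV : v \notin V by apply/negP => /Vu; rewrite leqNgt uv.
    rewrite -/(through _ _ _) IHd ?setU11 ?cardsU1 ?vV //.
      by move: ltd uv vm; clear; lia.
    by move=> x /setU1P[-> //|/Vu xu]; apply: leq_trans xu (ltnW uv).
  rewrite (sum_ord_itv (m + n) u.+1 p (fun v => psi (al ^+ (v - u.+1)) *
    coef2 (left_open #|V|.+1) (m - v.+1) n)); last by rewrite -mp leq_addr.
  rewrite coef2_zM; case: p mp mup => [|p] mp mup; first by rewrite big_ord0.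
  rewrite coef2_only_zM //; apply: eq_bigr => b _.
  rewrite coef2_moment_z // addKn; congr (_ * coef2 _ _ _).
  by move: mp; clear; lia.
(* The gap before the right letter [v] holds all [p] remaining left letters and [v - m] right ones.
   What follows is a series in w alone, so [M] supplies the whole power of z. *)
transitivity (\sum_(v < m + n | (m <= v < m + n)%N) psi (al ^+ p * ar ^+ (v - m)) *
    coef2 (right_open #|V| 1) 0 (m + n - v.+1)).
  apply: eq_big => v /=; first by move: um (ltn_ord v); clear; lia.
  case/andP=> /andP[uv vN]; rewrite -leqNgt => mv; congr (_ * _).
    have -> : ord_itv u.+1 v = @ord_itv (m + n) u.+1 (u.+1 + p + (v - m)).
      by rewrite -mp subnKC.
    by rewrite nc_sum_itv_psi -?mp ?subnKC ?(ltnW vN) ?leqnn ?orbT.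
  have vV : v \notin V by apply/negP => /Vu; rewrite leqNgt uv.
  rewrite -/(through _ _ _) through_right ?setU11 //.
    rewrite (card_sep_setU1 (fun x => x < m)%N) // (card_sep_setU1 (leq m)) //.
    by rewrite VL VR cards0 mv ltnNge mv.
  by move=> x /setU1P[-> //|/Vu xu]; apply: leq_trans xu (ltnW uv).
rewrite (sum_ord_itv (m + n) m n (fun v => psi (al ^+ p * ar ^+ (v - m)) *
    coef2 (right_open #|V| 1) 0 (m + n - v.+1))) //.
rewrite coef2_wM; case: n V u um uV Vu V0 VL VR IHd ltd mp mup => [|n] *; first by rewrite big_ord0.
rewrite coef2M_only_w; last exact: only_w_right_open.
apply: eq_bigr => b _.
rewrite coef2_moment_zw // addKn; congr (_ * coef2 _ _ _).
by clear; lia.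
Qed.

(** Words without left letters give [Fr]; in all others the first letter is left and opens a block
    with one left letter. *)
Lemma moment_zw_open : F = Fr + z * left_open 1.
Proof.
apply: fps2P => m n; rewrite coef2D coef2_zM coef2_moment_zw // coef2_moment_w //.
case: m => [|m]; first by rewrite expr0 mul1r addr0.
rewrite add0r -[phi _](@nc_sum_itv_phi (m.+1 + n) m.+1 0 m.+1 n) ?leqnn ?orbT //.
rewrite add0n (nc_sum_first _ _ _ _ ord0) // [LHS](through_left m.+1 n [set ord0] ord0) ?set11 //.
  by rewrite cards1 subn1.
by move=> v /set1P ->.
Qed.

Lemma moment_w_open : Fr = 1 + w * right_open 0 1.
Proof.
apply: fps2P => m n; rewrite coef2D coef2_wM coef2_moment_w // coef2_1.
case: m => [|m]; last by case: n => [|n]; rewrite ?addr0 // only_w_right_open addr0.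
case: n => [|n]; first by rewrite expr0 addr0.
rewrite add0r -[ar ^+ _]mul1r -(expr0 al).
rewrite -[phi _](@nc_sum_itv_phi n.+1 0 0 0 n.+1) //.
rewrite !add0n (nc_sum_first _ _ _ _ ord0) // [LHS](through_right n.+1 0 [set ord0] ord0) ?set11 //.
  rewrite subn1 (_ : [set x in [set ord0 : 'I_n.+1] | (x < 0)%N] = set0) ?cards0.
    rewrite (_ : [set x in [set ord0 : 'I_n.+1] | (0 <= x)%N] = [set ord0]) ?cards1 //.
    by apply/setP => x; rewrite !inE andbT.
  by apply/setP => x; rewrite !inE andbF.
by move=> v /set1P ->.
Qed.

(** The part of [moment_zw_open] of degree 0 in w: the mixed term drops out and [F] reduces to
    [Fl]. *)
Lemma moment_z_open : Fl = 1 + z * (S (z_cumulants 1) * Fl).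
Proof.
have zS : only_z (S (z_cumulants 1)) by apply: only_z_subst.
apply: fps2P => m n; rewrite coef2D coef2_zM coef2_1.
case: n => [|n]; last first.
  by rewrite zFl andbF add0r; case: m => // m; rewrite only_zM.
have := congr1 (fun f => coef2 f m 0) moment_zw_open.
rewrite coef2D coef2_zM coef2_moment_zw // mulr1 !coef2_moment_z // coef2_moment_w //.
case: m => [|m]; first by rewrite expr0 phi1 addr0.
rewrite !add0r => ->; rewrite coef2D -[w * M * _]mulrA coef2_wM addr0 !coef2_only_zM //.
by apply: eq_bigr => a _; rewrite coef2_moment_z // coef2_moment_zw // mulr1.
Qed.

Lemma c_cumulant_series_substE :
  fps2_subst (c_cumulant_series ckappa al ar) (z * Ml) (w * Mr) + 1
  = Ml + Mr + (1 - Ml / Fl) + (1 - Mr / Fr) - Ml * Mr / M * (1 - F / (Fl * Fr)).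
Proof.
have unit_of f : coef2 f 0 0 = 1 -> f \is a GRing.unit.
  by move=> f1; change (is_true (coef2 f 0 0 \is a GRing.unit)); rewrite f1 unitr1.
have uFl : Fl \is a GRing.unit by apply: unit_of.
have uFr : Fr \is a GRing.unit by apply: unit_of.
have uM : M \is a GRing.unit by apply: unit_of.
have := moment_zw_open; have := moment_w_open; have := moment_z_open.
rewrite c_cumulant_seriesE !substD substC !(subst_zM, subst_wM) // -/g -/h.
rewrite /left_open /right_open /S.
set A1 := fps2_subst (z_cumulants 1) g h; set B1 := fps2_subst (w_cumulants 0 1) g h.
set Y := fps2_subst (zw_cumulants 1 1) g h => FlE FrE FE.
have FlV : Fl^-1 = 1 - z * A1.
  by apply: (mulrI uFl); rewrite divrr // mulrBr mulr1 {1}FlE; ring.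
have FrV : Fr^-1 = 1 - w * B1.
  by apply: (mulrI uFr); rewrite divrr // mulrBr mulr1 {1}FrE; ring.
(* Moving the [A1] term of [FE] to the left gives [F * (1 - z * A1)], which is [F / Fl]. *)
have FV : F / (Fl * Fr) = 1 + z * w * M * Y.
  have FFl : F * Fl^-1 = Fr * (1 + z * w * M * Y) by rewrite FlV mulrBr {1}FE; ring.
  by rewrite invrM // (mulrC Fr^-1) mulrA FFl mulrAC divrr // mul1r.
have MV : Ml * Mr / M * (1 - (1 + z * w * M * Y)) = - (g * h * Y).
  transitivity (- (g * h * Y) * (M / M)); last by rewrite divrr // mulr1.
  by rewrite /g /h; ring.
have C1 : fps2C 1 = 1 :> fps2 K.
  by apply: fps2P => i j; rewrite coef2_1 /=; case: ifP.
(* No inverse is left, so the claim is a polynomial identity. *)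
by rewrite FlV FrV FV MV C1 /g /h; ring.
Qed.

End PairSeries.

Theorem theorem5p6 (R : realType) (A : algType R[i]) (phi psi : {scalar A})
    (phi1 : phi 1 = 1) (psi1 : psi 1 = 1)
    (kappa ckappa : cumulant_family R[i] A)
    (kappaP : is_lr_cumulants psi kappa)
    (ckappaP : is_c_lr_cumulants phi kappa ckappa)
    (al ar : A) :
  let Mpsi_l := moment_z psi al in
  let Mpsi_r := moment_w psi ar in
  let Mphi_l := moment_z phi al in
  let Mphi_r := moment_w phi ar in
  let Mpsi := moment_zw psi al ar in
  let Mphi := moment_zw phi al ar in
  fps2_subst (c_cumulant_series ckappa al ar)
      (fps2_z R[i] * Mpsi_l) (fps2_w R[i] * Mpsi_r) + 1
  = Mpsi_l + Mpsi_r + (1 - Mpsi_l / Mphi_l) + (1 - Mpsi_r / Mphi_r)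
    - Mpsi_l * Mpsi_r / Mpsi * (1 - Mphi / (Mphi_l * Mphi_r)).
Proof. exact: (c_cumulant_series_substE phi psi kappa). Qed.
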